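(* Define $$\Phi:\mathcal S^+(n)\longrightarrow\mathrm{Hol}(n)\oplus\mathrm{Diag}(n),\qquad\Phi(\Sigma):=\Bigl(\mathrm{off}(\log\Sigma),\ \mathrm{Diag}(\log\Sigma)-\mathcal D(\mathrm{off}(\log\Sigma))\Bigr).$$ Then $\Phi$ is a smooth diffeomorphism with inverse $$\Phi^{-1}(S,\Delta)=\exp\bigl(S+\mathcal D(S)+\Delta\bigr).$$ Let $g^{\mathrm{ext}}:=\Phi^*\langle\cdot,\cdot\rangle$ be the corresponding log-Euclidean metric on $\mathcal S^+(n)$, where $\langle\cdot,\cdot\rangle$ is the Frobenius inner product on $\mathrm{Hol}(n)\oplus\mathrm{Diag}(n)$. Then the inclusion $$i:(\mathrm{Cor}^+(n),g^{\mathrm{OL}})\hookrightarrow(\mathcal S^+(n),g^{\mathrm{ext}})$$ is a Riemannian isometric embedding. Moreover, $i(\mathrm{Cor}^+(n))$ is totally geodesic and corresponds, in $\Phi$-coordinates, to the linear subspace $\mathrm{Hol}(n)\oplus\{0\}$, i.e. $\Phi(\mathrm{Cor}^+(n))=\mathrm{Hol}(n)\oplus\{0\}$.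
   Context: $\mathcal S(n)$ = real symmetric $n\times n$ matrices, $\mathcal S^+(n)$ = symmetric positive-definite ones, $\mathrm{Cor}^+(n)$ = matrices in $\mathcal S^+(n)$ with unit diagonal, $\mathrm{Hol}(n)$ = symmetric matrices with zero diagonal, $\mathrm{Diag}(n)$ = diagonal matrices. $\mathrm{Diag}(A)$ is the diagonal part of $A$, $\mathrm{off}(A)=A-\mathrm{Diag}(A)$; $\exp,\log$ are the matrix exponential and logarithm. The Frobenius inner product on symmetric matrices is $\langle A,B\rangle=\mathrm{tr}(AB)$; on $\mathrm{Hol}(n)\oplus\mathrm{Diag}(n)$ it is the product inner product $\langle(S,\Delta),(S',\Delta')\rangle=\mathrm{tr}(SS')+\mathrm{tr}(\Delta\Delta')$. Known facts: for each $S\in\mathcal S(n)$ there is a unique $\mathcal D(S)\in\mathrm{Diag}(n)$ (the diagonal correction) with $\exp(S+\mathcal D(S))\in\mathrm{Cor}^+(n)$, and $\mathcal D$ is smooth; $\mathrm{Log}:=\mathrm{off}\circ\log:\mathrm{Cor}^+(n)\to\mathrm{Hol}(n)$ is a diffeomorphism with inverse $S\mapsto\exp(S+\mathcal D(S))$. The off-log metric on $\mathrm{Cor}^+(n)$ is $g^{\mathrm{OL}}=\mathrm{Log}^*\langle\cdot,\cdot\rangle$. *)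

(* Defs.v *)
From HB Require Import structures.
From mathcomp Require Import all_boot all_order all_algebra.
From mathcomp Require Import all_classical all_reals all_analysis.

Set Implicit Arguments.
Unset Strict Implicit.
Unset Printing Implicit Defensive.

Import Order.TTheory GRing.Theory Num.Theory.
Import numFieldNormedType.Exports.

Local Open Scope classical_set_scope.
Local Open Scope ring_scope.

(** * Smooth maps between subsets of (finite-dimensional) normed spaces *)

(* On a finite-dimensional E, pointwise continuity of x |-> 'd f x v for every
   v is continuity of the differential, so this is the usual class C^k on an
   open set U. *)
Fixpoint Ck (R : realType) (E F : normedModType R) (k : nat) (U : set E)
    (f : E -> F) : Prop :=
  if k is k'.+1 then
    (forall x, U x -> differentiable f x) /\
    (forall v : E, Ck k' U (fun x => 'd f x v))
  else forall x, U x -> {for x, continuous f}.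

(* A map on an arbitrary subset X is smooth when it extends, near each point
   of X, to a C^oo map on an open set of the ambient space; the values of f
   outside X are irrelevant. *)
Definition smooth_on (R : realType) (E F : normedModType R) (X : set E)
    (f : E -> F) : Prop :=
  forall x, X x -> exists (U : set E) (f' : E -> F),
    [/\ open U, U x, (forall k, Ck k U f') &
        forall y, U y -> X y -> f' y = f y].

Definition diffeomorphism (R : realType) (E F : normedModType R)
    (X : set E) (Y : set F) (f : E -> F) (finv : F -> E) : Prop :=
  [/\ (forall x, X x -> Y (f x)), (forall y, Y y -> X (finv y)),
      (forall x, X x -> finv (f x) = x), (forall y, Y y -> f (finv y) = y) &
      smooth_on X f /\ smooth_on Y finv].

(** * Riemannian geometry of relatively open subsets of affine subspaces *)

(* X is a submanifold which near each of its points x is the affine subspace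
   x + V; its tangent space at every point is the linear subspace V. For u in
   V the directional derivative 'D_u f x only involves values of f on X. *)
Definition flat_submanifold (R : realType) (E : normedModType R)
    (X V : set E) : Prop :=
  [/\ V 0, (forall (a : R) u v, V u -> V v -> V (a *: u + v)) &
      forall x, X x -> \forall y \near x, X y <-> V (y - x)].

(* g x u v is the value at x of the metric on the tangent vectors u, v. *)
Definition riemannian_manifold (R : realType) (E : normedModType R)
    (X V : set E) (g : E -> E -> E -> R) : Prop :=
  [/\ flat_submanifold X V,
      (forall x, X x -> forall (a : R) u v w, V u -> V v -> V w ->
         g x (a *: u + v) w = a * g x u w + g x v w),
      (forall x, X x -> forall u v, V u -> V v -> g x u v = g x v u),
      (forall x, X x -> forall u, V u -> u != 0 -> 0 < g x u u) &
      forall u v, V u -> V v -> smooth_on X (fun x => g x u v)].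

Definition pullback_metric (R : realType) (E F : normedModType R)
    (f : E -> F) (h : F -> F -> F -> R) : E -> E -> E -> R :=
  fun x u v => h (f x) ('D_u f x) ('D_v f x).

(* An injective immersion which is a homeomorphism onto its image. *)
Definition smooth_embedding (R : realType) (E F : normedModType R)
    (X V : set E) (Y : set F) (f : E -> F) : Prop :=
  [/\ (forall x, X x -> Y (f x)),
      smooth_on X f,
      (forall x u, X x -> V u -> 'D_u f x = 0 -> u = 0) &
      exists finv : F -> E, (forall x, X x -> finv (f x) = x) /\
        {within f @` X, continuous finv}].

Definition riemannian_isometric_embedding (R : realType)
    (E F : normedModType R)
    (X V : set E) (g : E -> E -> E -> R) (Y W : set F) (h : F -> F -> F -> R)
    (f : E -> F) : Prop :=
  [/\ riemannian_manifold X V g, riemannian_manifold Y W h,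
      smooth_embedding X V Y f &
      forall x u v, X x -> V u -> V v -> pullback_metric f h x u v = g x u v].

(* c is the Christoffel vector Gamma_x(u, v) of the Levi-Civita connection:
   Koszul's formula for constant vector fields u, v, w. *)
Definition is_christoffel (R : realType) (E : normedModType R)
    (V : set E) (g : E -> E -> E -> R) (x u v c : E) : Prop :=
  V c /\ forall w, V w ->
    g x c w = 2^-1 * ('D_u (fun y => g y v w) x + 'D_v (fun y => g y u w) x
                      - 'D_w (fun y => g y u v) x).

(* The geodesic equation gamma'' + Gamma_gamma(gamma', gamma') = 0 on the open
   interval I. *)
Definition geodesic (R : realType) (E : normedModType R)
    (X V : set E) (g : E -> E -> E -> R) (I : set R) (gamma : R -> E) : Prop :=
  [/\ (forall t, I t -> X (gamma t)), smooth_on I gamma &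
      forall t, I t ->
        is_christoffel V g (gamma t) (derive1 gamma t) (derive1 gamma t)
          (- derive1n 2 gamma t)].

(* Every geodesic of the submanifold N (with tangent space T) for the induced
   metric, i.e. g restricted to N and T, is a geodesic of (X, g). *)
Definition totally_geodesic (R : realType) (E : normedModType R)
    (N T X V : set E) (g : E -> E -> E -> R) : Prop :=
  [/\ N `<=` X, flat_submanifold N T &
      forall (I : set R) (gamma : R -> E), open I -> is_interval I ->
        geodesic N T g I gamma -> geodesic X V g I gamma].

(** * Symmetric and correlation matrices *)

Definition Sym (R : realType) (n : nat) : set 'M[R]_n :=
  [set A | A^T = A].

Definition SymPos (R : realType) (n : nat) : set 'M[R]_n :=
  [set A | A^T = A /\
     forall x : 'rV[R]_n, x != 0 -> 0 < (x *m A *m x^T) 0 0].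

Definition CorPos (R : realType) (n : nat) : set 'M[R]_n :=
  [set A | SymPos A /\ forall i, A i i = 1].

Definition Hol (R : realType) (n : nat) : set 'M[R]_n :=
  [set A | A^T = A /\ forall i, A i i = 0].

Definition Diag (R : realType) (n : nat) : set 'M[R]_n :=
  [set A | is_diag_mx A].

Definition diagpart (R : realType) (n : nat) (A : 'M[R]_n) : 'M[R]_n :=
  diag_mx (\row_i A i i).

Definition off (R : realType) (n : nat) (A : 'M[R]_n) : 'M[R]_n :=
  A - diagpart A.

Definition expmx (R : realType) (n : nat) (A : 'M[R]_n) : 'M[R]_n :=
  limn (series (fun k => k`!%:R^-1 *: A ^+ k)).

(* The principal logarithm of a symmetric positive-definite matrix: its
   symmetric logarithm, which is unique (junk for other arguments). *)
Definition logmx (R : realType) (n : nat) (A : 'M[R]_n) : 'M[R]_n :=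
  xget 0 [set L | Sym L /\ expmx L = A].

(* The diagonal correction: for symmetric S, such a D exists and is unique. *)
Definition diagcorr (R : realType) (n : nat) (S : 'M[R]_n) : 'M[R]_n :=
  xget 0 [set D | Diag D /\ CorPos (expmx (S + D))].

(** * The metrics *)

Definition frob (R : realType) (n : nat) (A B : 'M[R]_n) : R := \tr (A *m B).

Definition frob2 (R : realType) (n : nat) (p q : 'M[R]_n * 'M[R]_n) : R :=
  frob p.1 q.1 + frob p.2 q.2.

Definition offlog (R : realType) (n : nat) (C : 'M[R]_n) : 'M[R]_n :=
  off (logmx C).

Definition gOL (R : realType) (n : nat) :
    'M[R]_n -> 'M[R]_n -> 'M[R]_n -> R :=
  pullback_metric (@offlog R n) (fun _ => @frob R n).

Definition Phi (R : realType) (n : nat) (A : 'M[R]_n) : 'M[R]_n * 'M[R]_n :=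
  (off (logmx A), diagpart (logmx A) - diagcorr (off (logmx A))).

Definition Phiinv (R : realType) (n : nat) (p : 'M[R]_n * 'M[R]_n) :
    'M[R]_n :=
  expmx (p.1 + diagcorr p.1 + p.2).

Definition gext (R : realType) (n : nat) :
    'M[R]_n -> 'M[R]_n -> 'M[R]_n -> R :=
  pullback_metric (@Phi R n) (fun _ => @frob2 R n).

(* Main.v *)
(** Everything about exp rests on two facts. For real symmetric A and B with
    spectral decompositions of eigenvalues a_i, b_j and orthogonal change of
    basis W,
      tr (f(A) g(B)) = \sum_ij f(a_i) g(b_j) W_ij^2,
    so scalar inequalities for exp become trace inequalities: a quantitative
    strict monotonicity of exp on symmetric matrices (injectivity, continuity
    of inverses, positivity of the differential) and Klein's inequality (the
    diagonal correction is a minimiser of D |-> tr exp(S + D) - tr D). Next, exp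
    of the block matrix [[B, X], [0, A]] has in its upper right corner a linear
    function of X which takes the value exp B - exp A at X = B - A; hence the
    differential of exp at A is X |-> ursub exp [[A, X], [0, A]], and smoothness
    of exp follows by induction over all matrix sizes.

    log and the diagonal correction are then smooth by the implicit function
    theorem, since S |-> exp S and S |-> off S + Diag (exp S) have injective
    differentials; so Phi is a diffeomorphism. In the flat metric pulled back
    by Phi the geodesic equation reads <dPhi(g'') + d^2 Phi(g', g'), dPhi w> = 0.
    On correlation matrices the left entry Z lies in Hol + {0}, which is the
    image under dPhi of the hollow matrices w, so testing against hollow w
    already forces Z = 0. *)
Require Import Defs.
From HB Require Import structures.
From mathcomp Require Import all_boot all_order all_algebra.
From mathcomp Require Import all_classical all_reals all_analysis.
From mathcomp Require Import ring lra.
Set Implicit Arguments.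
Unset Strict Implicit.
Unset Printing Implicit Defensive.
Import Order.TTheory GRing.Theory Num.Theory.
Import numFieldNormedType.Exports.
Local Open Scope classical_set_scope.
Local Open Scope ring_scope.

(** The sets at hand are not open in the space of all matrices, and [Phi] is arbitrary off the
    symmetric ones. Regularity is therefore proved for extensions such as [sym_Phi], and facts
    return to [Phi] through directional derivatives, which see a function only along a line. For the
    same reason the equations given to the implicit function theorem are completed to maps of the
    whole matrix space: the skew part is sent to itself, so injectivity of the differential on
    symmetric directions becomes injectivity outright.

    That theorem is used in a weak form: the solution is known to exist, and its continuity is a
    hypothesis. This continuity is the obstacle, since no bound on the solution at nearby points is
    known beforehand. The monotonicity estimate is shaped to cope: its constant grows only linearly
    in the norm of the second matrix, and a small enough right-hand side absorbs this growth.

    Tangency is handled by linear maps: being symmetric, hollow or in Hol + {0} is the vanishing of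
    a linear map, an equation that derivatives inherit. *)

(** * Norms, convergence and linear maps of matrices *)

Lemma mxnorm_ge (R : realType) m n (A : 'M[R]_(m, n)) i j : `|A i j| <= `|A|.
Proof.
rewrite [leRHS]/Num.Def.normr/= mx_normrE.
exact: (le_bigmax _ (fun ij => `|A ij.1 ij.2|) (i, j)).
Qed.

Lemma mxnorm_le (R : realType) m n (A : 'M[R]_(m, n)) (c : R) :
  0 <= c -> (forall i j, `|A i j| <= c) -> `|A| <= c.
Proof.
move=> c0 Ac; rewrite [leLHS]/Num.Def.normr/= mx_normrE.
by apply: bigmax_le => // -[i j] _; exact: Ac.
Qed.

Lemma mxnormM (R : realType) m n p (A : 'M[R]_(m, n)) (B : 'M[R]_(n, p)) :
  `|A *m B| <= n%:R * (`|A| * `|B|).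
Proof.
apply: mxnorm_le => [|i j]; first by rewrite !mulr_ge0.
rewrite mxE (le_trans (ler_norm_sum _ _ _))//.
rewrite -[n in n%:R]card_ord -sumr_const mulr_suml ler_sum// => k _.
by rewrite mul1r normrM ler_pM// mxnorm_ge.
Qed.

Lemma mxnormX (R : realType) n (A : 'M[R]_n) k :
  `|A ^+ k| <= (n%:R * `|A| + 1) ^+ k.
Proof.
elim: k => [|k IH]; rewrite ?expr0.
  by apply: mxnorm_le => // i j; rewrite mxE; case: (_ == _); rewrite ?normr1 ?normr0.
rewrite !exprS [A * _](_ : _ = A *m A ^+ k)// (le_trans (mxnormM _ _))//.
rewrite mulrA ler_pM ?mulr_ge0//; by rewrite lerDl.
Qed.

Lemma cvg_mxP (R : realType) (T : Type) (F : set_system T) {FF : Filter F} m n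
    (f : T -> 'M[R]_(m, n)) (M : 'M[R]_(m, n)) :
  f @ F --> M <-> forall i j, (fun t => f t i j) @ F --> M i j.
Proof.
split=> [fM i j|fM]; apply/cvgrPdist_le => e e0.
  move/cvgrPdist_le : fM => /(_ _ e0); apply: filterS => t.
  by apply: le_trans; have := mxnorm_ge (M - f t) i j; rewrite !mxE.
have : \forall t \near F, forall ij : 'I_m * 'I_n, `|M ij.1 ij.2 - f t ij.1 ij.2| <= e.
  apply: filter_forall => -[i j] /=.
  by have /cvgrPdist_le /(_ _ e0) := fM i j.
apply: filterS => t H; apply: mxnorm_le; first exact: ltW.
by move=> i j; rewrite !mxE; exact: (H (i, j)).
Qed.

Lemma cvg_fin_sum (R : realType) (V : normedModType R) (T : Type)
    (F : set_system T) {FF : Filter F} (I : Type) (r : seq I)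
    (f : I -> T -> V) (l : I -> V) :
  (forall i, f i @ F --> l i) -> (fun t => \sum_(i <- r) f i t) @ F --> \sum_(i <- r) l i.
Proof. by move=> fl; apply: cvg_big => //; exact: add_continuous. Qed.

Section linear_maps.
Context (R : realType) (m n : nat) (V : normedModType R).
Implicit Type f : 'M[R]_(m, n) -> V.

Lemma linear_mx_sum f : linear f ->
  forall A, f A = \sum_i \sum_j A i j *: f (delta_mx i j).
Proof.
move=> lf; pose L : {linear 'M[R]_(m, n) -> V} :=
  HB.pack f (GRing.isLinear.Build _ _ _ _ f lf).
move=> A; rewrite -[LHS]/(L A) {1}(matrix_sum_delta A) linear_sum.
by apply: eq_bigr => i _; rewrite linear_sum; apply: eq_bigr => j _; rewrite linearZ.
Qed.

Lemma linear_mx_continuous f : linear f -> continuous f.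
Proof.
move=> /linear_mx_sum fE; rewrite (_ : f =
    fun A => \sum_i \sum_j A i j *: f (delta_mx i j)).
  move=> A; apply: (@cvg_fin_sum _ _ _ (nbhs A)) => i.
  apply: (@cvg_fin_sum _ _ _ (nbhs A)) => j.
  by apply: cvgZr_tmp; exact: coord_continuous.
by apply/funext.
Qed.

End linear_maps.

(** * The exponential series and its algebraic identities *)

Section expmx.
Context (R : realType).

Lemma is_cvg_series_expmx n (A : 'M[R]_n) :
  cvgn (series (fun k => k`!%:R^-1 *: A ^+ k)).
Proof.
apply: (@cvgP _ _ (\matrix_(i, j)
  limn (series (fun k => (k`!%:R^-1 *: A ^+ k) i j)))).
apply/cvg_mxP => i j; rewrite mxE.
rewrite (_ : (fun t => _) = series (fun k => (k`!%:R^-1 *: A ^+ k) i j)); last first.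
  by apply/funext => N; rewrite /series/= summxE.
apply: normed_cvg.
apply: (series_le_cvg _ _ _ (is_cvg_series_exp_coeff (n%:R * `|A| + 1))) => k /=.
- exact: normr_ge0.
- by rewrite divr_ge0// exprn_ge0// addr_ge0// mulr_ge0.
- rewrite (le_trans (mxnorm_ge _ _ _))// normrZ mulrC ger0_norm ?invr_ge0//.
  by rewrite ler_pM2r ?invr_gt0 ?ltr0n ?fact_gt0// mxnormX.
Qed.

Lemma cvg_expmx n (A : 'M[R]_n) :
  series (fun k => k`!%:R^-1 *: A ^+ k) @ \oo --> expmx A.
Proof. exact: is_cvg_series_expmx. Qed.

(** Linear maps on matrices are continuous, so they pass through the series. The two matrices may
    have different sizes: this is how identities about powers, including those about corners of
    block matrices, become identities about exponentials. *)
Lemma expmx_linear n m (V : normedModType R) (A : 'M[R]_n) (B : 'M[R]_m)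
    (f : 'M[R]_n -> V) (g : 'M[R]_m -> V) :
  linear f -> linear g -> (forall k, f (A ^+ k) = g (B ^+ k)) ->
  f (expmx A) = g (expmx B).
Proof.
move=> lf lg fg.
have seriesE p (C : 'M[R]_p) h : linear h ->
    (fun N => \sum_(0 <= k < N) k`!%:R^-1 *: h (C ^+ k)) @ \oo --> (h (expmx C) : V).
  move=> lh; pose L : {linear 'M[R]_p -> V} :=
    HB.pack h (GRing.isLinear.Build _ _ _ _ h lh).
  rewrite (_ : (fun N => _) = L \o series (fun k => k`!%:R^-1 *: C ^+ k)).
    by apply: continuous_cvg; [exact: linear_mx_continuous lh _|exact: cvg_expmx].
  apply/funext => N; rewrite /series/= -[RHS]/(L _) linear_sum.
  by apply: eq_bigr => k _; rewrite linearZ.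
have fgE : (fun N => \sum_(0 <= k < N) k`!%:R^-1 *: f (A ^+ k)) =
    (fun N => \sum_(0 <= k < N) k`!%:R^-1 *: g (B ^+ k)).
  by apply/funext => N; apply: eq_bigr => k _; rewrite fg.
have := seriesE _ A f lf; rewrite fgE => cA.
exact: (cvg_unique _ cA (seriesE _ B g lg)).
Qed.

Lemma expmxE n (A : 'M[R]_n) i j :
  expmx A i j = limn (series (fun k => k`!%:R^-1 * (A ^+ k) i j)).
Proof.
apply/esym/cvg_lim => //.
have /cvg_mxP /(_ i j) := @cvg_expmx _ A.
rewrite (_ : (fun t => _) = series (fun k => k`!%:R^-1 * (A ^+ k) i j))//.
by apply/funext => N; rewrite /series/= summxE; apply: eq_bigr => k _; rewrite mxE.
Qed.

Lemma expmx_bound n (A : 'M[R]_n) : `|expmx A| <= expR (n%:R * `|A| + 1).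
Proof.
apply: mxnorm_le => [|i j]; first exact: expR_ge0.
have /cvg_mxP /(_ i j)/cvg_norm Ac := @cvg_expmx _ A.
have bc := is_cvg_series_exp_coeff (n%:R * `|A| + 1).
rewrite -(cvg_lim _ Ac)//; apply: ler_lim => //; first by apply/cvgP; exact: Ac.
apply: nearW => N; rewrite /series/= summxE (le_trans (ler_norm_sum _ _ _))//.
apply: ler_sum => k _; rewrite (le_trans (mxnorm_ge _ _ _))// normrZ mulrC.
rewrite ger0_norm ?invr_ge0//.
by rewrite ler_pM2r ?invr_gt0 ?ltr0n ?fact_gt0// mxnormX.
Qed.

Lemma trmxX n (A : 'M[R]_n) k : (A ^+ k)^T = A^T ^+ k.
Proof.
elim: k => [|k IH]; first by rewrite !expr0 trmx1.
by rewrite exprS [A * _]/(A *m _) trmx_mul IH exprSr.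
Qed.

Lemma expmx_tr n (A : 'M[R]_n) : (expmx A)^T = expmx A^T.
Proof.
apply: (@expmx_linear _ _ _ _ _ trmx id) => //.
- by move=> a u v; rewrite linearP.
- exact: trmxX.
Qed.

Lemma expmx_sym n (A : 'M[R]_n) : Sym A -> Sym (expmx A).
Proof. by rewrite /Sym/= expmx_tr => ->. Qed.

Lemma expmx_conj n (P A : 'M[R]_n) : P *m P^T = 1%:M ->
  expmx (P^T *m A *m P) = P^T *m expmx A *m P.
Proof.
move=> PP; apply: (@expmx_linear _ _ _ _ _ id (fun X => P^T *m X *m P)) => //.
  by move=> a u v; rewrite mulmxDr mulmxDl -scalemxAr -scalemxAl.
elim=> [|k IH]; first by rewrite !expr0 mulmx1 (mulmx1C PP).
rewrite !exprS -!mulmxE IH !mulmxA.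
by rewrite -(mulmxA _ P P^T) PP mulmx1.
Qed.

Lemma expmx_diag n (d : 'rV[R]_n) :
  expmx (diag_mx d) = diag_mx (\row_i expR (d 0 i)).
Proof.
have dX k : diag_mx d ^+ k = diag_mx (\row_i d 0 i ^+ k).
  elim: k => [|k IH].
    by apply/matrixP => i j; rewrite expr0 !mxE expr0.
  rewrite exprS IH -mulmxE mul_diag_mx; apply/matrixP => i j.
  by rewrite !mxE mulrnAr exprS.
apply/matrixP => i j; rewrite expmxE !mxE.
case: (eqVneq i j) => [->|ij].
  rewrite mulr1n /expR; congr (limn (series _)); apply/funext => k.
  by rewrite dX !mxE eqxx mulr1n mulrC.
rewrite mulr0n; apply/cvg_lim => //.
rewrite (_ : series _ = cst 0); first exact: cvg_cst.
apply/funext => N; rewrite /series/= big1// => k _.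
by rewrite dX !mxE (negbTE ij) mulr0n mulr0.
Qed.

End expmx.

(** * The real spectral theorem *)

Section spectral.
Context (R : realType).

Lemma mx11E (M : 'M[R]_1) : M = (M 0 0)%:M.
Proof. by apply/matrixP => i j; rewrite !ord1 !mxE. Qed.

Lemma mxBE m n (M N : 'M[R]_(m, n)) i j : (M - N) i j = M i j - N i j.
Proof. by rewrite !mxE. Qed.

Lemma sqnormE n (x : 'rV[R]_n) : (x *m x^T) 0 0 = \sum_i x 0 i ^+ 2.
Proof. by rewrite mxE; apply: eq_bigr => i _; rewrite mxE expr2. Qed.

Lemma sqnorm_ge0 n (x : 'rV[R]_n) : 0 <= (x *m x^T) 0 0.
Proof. by rewrite sqnormE sumr_ge0// => i _; rewrite sqr_ge0. Qed.

Lemma sqnorm_eq0 n (x : 'rV[R]_n) : (x *m x^T) 0 0 = 0 -> x = 0.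
Proof.
rewrite sqnormE => /eqP; rewrite psumr_eq0 => [/allP x0|i _]; last exact: sqr_ge0.
apply/rowP => i; rewrite mxE; apply/eqP.
by have := x0 i (mem_index_enum _); rewrite /= sqrf_eq0.
Qed.

Lemma quad_continuous n (A : 'M[R]_n) :
  continuous (fun x : 'rV[R]_n => (x *m A *m x^T) 0 0).
Proof.
rewrite (_ : (fun _ => _) = fun x : 'rV[R]_n => \sum_k (\sum_j x 0 j * A j k) * x 0 k).
  move=> x; apply: (@cvg_fin_sum _ _ _ (nbhs x)) => k.
  apply: (@cvgM _ _ (nbhs x)); last exact: coord_continuous.
  apply: (@cvg_fin_sum _ _ _ (nbhs x)) => j.
  by apply: cvgMr_tmp; exact: coord_continuous.
by apply/funext => x; rewrite !mxE; apply: eq_bigr => k _; rewrite !mxE.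
Qed.

(** Moving c in the direction - c M would lower the form at first order unless c M = 0, and c is
    already a zero of a nonnegative form. *)
Lemma psd_kernel n (M : 'M[R]_n) (c : 'rV[R]_n) : M^T = M ->
  (forall x : 'rV[R]_n, 0 <= (x *m M *m x^T) 0 0) ->
  (c *m M *m c^T) 0 0 = 0 -> c *m M = 0.
Proof.
move=> Msym psd cMc; set y := c *m M.
have qE (t : R) : ((c - t *: y) *m M *m (c - t *: y)^T) 0 0 =
    - (2 * t * (y *m y^T) 0 0) + t ^+ 2 * (y *m M *m y^T) 0 0.
  have -> : (c - t *: y) *m M *m (c - t *: y)^T = c *m M *m c^T -
      t *: (c *m M *m y^T) - t *: (y *m M *m c^T) + (t ^+ 2) *: (y *m M *m y^T).
    rewrite [(c - _)^T]linearB/= [(_ *: y)^T]linearZ/= mulmxBl.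
    rewrite -scalemxAl mulmxBr !mulmxBl -!scalemxAl.
    rewrite -!scalemxAr scalerA -expr2 opprB addrA addrAC.
    by congr (_ + _); rewrite addrAC.
  have -> : c *m M *m y^T = y *m y^T by [].
  have -> : y *m M *m c^T = y *m y^T by rewrite /y trmx_mul Msym mulmxA.
  move: (c *m M *m c^T) cMc (y *m y^T) (y *m M *m y^T) => X X0 Y Z.
  by rewrite !mxE X0; ring.
apply: sqnorm_eq0; apply/eqP; rewrite eq_le sqnorm_ge0 andbT.
set a : R := (y *m y^T) 0 0 in qE *; set b : R := (y *m M *m y^T) 0 0 in qE.
have b0 : 0 <= b by exact: psd.
(* The value t = a / (b + 1) makes - 2 t a + t^2 b negative unless a = 0; the + 1 allows b = 0. *)
have := psd (c - (a / (b + 1)) *: y); rewrite qE.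
have b1 : 0 < b + 1 by rewrite ltr_wpDl.
have -> : - (2 * (a / (b + 1)) * a) + (a / (b + 1)) ^+ 2 * b =
  - (a ^+ 2 * (b + 2)) / (b + 1) ^+ 2 by field; rewrite gt_eqF.
rewrite pmulr_lge0 ?invr_gt0 ?exprn_gt0// oppr_ge0 pmulr_lle0; last by rewrite ltr_wpDl.
by move=> a2; rewrite le_eqVlt -sqrf_eq0 eq_le a2 sqr_ge0.
Qed.

(** Let c maximise x A x^T on the unit sphere, with maximum l. The form of l - A is nonnegative and
    vanishes at c, so [psd_kernel] gives c A = l c without Lagrange multipliers. *)
Lemma sym_eigenvector n (A : 'M[R]_n.+1) : A^T = A ->
  exists (l : R) (c : 'rV[R]_n.+1), (c *m c^T) 0 0 = 1 /\ c *m A = l *: c.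
Proof.
move=> Asym; pose K := [set x : 'rV[R]_n.+1 | (x *m 1%:M *m x^T) 0 0 = 1].
have K0 : K !=set0.
  exists (delta_mx 0 0); rewrite /K/= mulmx1 sqnormE (bigD1 0)//= big1.
    by rewrite mxE !eqxx expr1n addr0.
  by move=> i i0; rewrite mxE (negbTE i0) andbF expr0n.
have Kco : compact K.
  apply: bounded_closed_compact.
    exists 1; split=> [|M M1 x]; first exact: num_real.
    rewrite /K/= mulmx1 sqnormE => x1; apply: mxnorm_le; first by lra.
    move=> i j; rewrite ord1; apply: (le_trans _ (ltW M1)).
    rewrite -(@ler_pXn2r _ 2)// ?nnegrE// expr1n -normrX ger0_norm ?sqr_ge0//.
    by rewrite -x1 (bigD1 j)//= lerDl sumr_ge0// => k _; exact: sqr_ge0.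
  rewrite (_ : K = (fun x : 'rV[R]_n.+1 => (x *m 1%:M *m x^T) 0 0) @^-1` [set 1])//.
  by apply: preimage_closed => [x _|]; [exact: quad_continuous|exact: closed_eq].
have [c] := EVT_max_rV K0 Kco (continuous_subspaceT (@quad_continuous _ A)).
rewrite inE /K/= mulmx1 => cK cmax.
exists ((c *m A *m c^T) 0 0), c; split => //; set l : R := (c *m A *m c^T) 0 0.
have qle (x : 'rV[R]_n.+1) : (x *m A *m x^T) 0 0 <= l * (x *m x^T) 0 0.
  have [->|x0] := eqVneq x 0; first by rewrite !mul0mx !mxE mulr0.
  have s0 : 0 < (x *m x^T) 0 0.
    rewrite lt_def sqnorm_ge0 andbT; apply: contra_neq x0; exact: sqnorm_eq0.
  set s : R := (x *m x^T) 0 0 in s0 *.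
  pose y := (Num.sqrt s)^-1 *: x.
  have yE (B : 'M[R]_n.+1) : (y *m B *m y^T) 0 0 = s^-1 * (x *m B *m x^T) 0 0.
    rewrite /y linearZ/= -!scalemxAl -!scalemxAr !mxE mulrA -expr2 exprVn.
    by rewrite sqr_sqrtr ?ltW.
  have := cmax y; rewrite inE /K/= yE mulmx1 -/s mulVf ?gt_eqF// => /(_ erefl).
  by rewrite yE mulrC ler_pdivrMr.
have /eqP : c *m (l%:M - A) = 0.
  apply: psd_kernel.
  - by rewrite linearB/= tr_scalar_mx Asym.
  - move=> x; rewrite mulmxBr mulmxBl mul_mx_scalar -scalemxAl 2!mxE [X in _ + X]mxE.
    by rewrite subr_ge0.
  - rewrite mulmxBr mulmxBl mul_mx_scalar -scalemxAl 2!mxE [X in _ + X]mxE cK mulr1.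
    by rewrite subrr.
by rewrite mulmxBr mul_mx_scalar subr_eq0 => /eqP <-.
Qed.

(* P is the Householder reflection along v - e. *)
Lemma orthogonal_transitive n (e v : 'rV[R]_n) :
  (e *m e^T) 0 0 = 1 -> (v *m v^T) 0 0 = 1 ->
  exists P : 'M[R]_n, P *m P^T = 1%:M /\ e *m P = v.
Proof.
move=> e1 v1; have [->|ev] := eqVneq e v.
  by exists 1%:M; rewrite trmx1 !mulmx1.
pose w := v - e; pose s : R := (w *m w^T) 0 0.
have s0 : s != 0.
  by apply: contra_neq ev => /sqnorm_eq0/eqP; rewrite subr_eq0 => /eqP.
have ve : (v *m e^T) 0 0 = (e *m v^T) 0 0.
  by rewrite -[v *m e^T]trmxK trmx_mul trmxK mxE.
have sE : s = 2 - 2 * (e *m v^T) 0 0.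
  by rewrite /s /w linearB/= mulmxBr !mulmxBl !mxBE e1 v1 ve; ring.
have ew : (e *m w^T) 0 0 = - (s / 2).
  by rewrite /w linearB/= mulmxBr mxBE e1 sE; field.
have ws : (w *m w^T) 0 0 = s by []; have ->: v = e + w by rewrite addrC subrK.
clear sE ve; clearbody s; clearbody w; pose H : 'M[R]_n := 1%:M - (2 / s) *: (w^T *m w).
have HT : H^T = H by rewrite /H linearB/= linearZ/= trmx_mul trmxK trmx1.
exists H; rewrite HT; split.
  have ww : w^T *m w *m (w^T *m w) = s *: (w^T *m w).
    by rewrite mulmxA -(mulmxA w^T w) (mx11E (w *m w^T)) ws mul_mx_scalar scalemxAl.
  rewrite /H mulmxBl mul1mx mulmxBr mulmx1 -!scalemxAl -!scalemxAr ww !scalerA.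
  rewrite [2 / s * (2 / s) * s](_ : _ = 2 / s + 2 / s); last by field.
  by rewrite scalerDl opprB addrK subrK.
rewrite /H mulmxBr mulmx1 -scalemxAr mulmxA (mx11E (e *m w^T)) ew mul_scalar_mx.
rewrite scalerA (_ : 2 / s * _ = -1); last by field.
by rewrite scaleN1r opprK.
Qed.

(** Induction by deflation: an orthogonal matrix carries the first basis vector to a unit
    eigenvector, after which the conjugated matrix splits into a 1 by 1 block and a smaller
    symmetric block. *)
Theorem sym_spectral n (A : 'M[R]_n) : A^T = A ->
  exists (P : 'M[R]_n) (d : 'rV[R]_n),
    P *m P^T = 1%:M /\ A = P^T *m diag_mx d *m P.
Proof.
elim: n A => [A _|n IH A Asym].
  by exists 1%:M, 0; split; apply/matrixP => -[].
have [l [c [c1 cA]]] := sym_eigenvector Asym.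
pose e : 'rV[R]_(1 + n) := row_mx 1%:M 0.
have e1 : (e *m e^T) 0 0 = 1.
  by rewrite /e tr_row_mx mul_row_col trmx1 mulmx1 mul0mx addr0 mxE.
have [P [PP eP]] := orthogonal_transitive e1 c1.
have PP' : P^T *m P = 1%:M by exact: mulmx1C.
pose B : 'M[R]_(1 + n) := P *m A *m P^T.
have BT : B^T = B by rewrite /B !trmx_mul trmxK Asym mulmxA.
have eB : e *m B = l *: e.
  by rewrite /B !mulmxA eP cA -scalemxAl -eP -mulmxA PP mulmx1.
have AE : A = P^T *m B *m P.
  by rewrite /B !mulmxA PP' mul1mx -mulmxA PP' mulmx1.
have := eB; rewrite -{1}(submxK B) /e mul_row_block !mul1mx !mul0mx !addr0.
rewrite scale_row_mx scaler0 => /eq_row_mx[Bul Bur].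
have Bdl : dlsubmx B = 0.
  by rewrite -BT -trmx_ursub Bur trmx0.
have [|Q [d [QQ DE]]] := IH (drsubmx B); first by rewrite trmx_drsub BT.
pose Q' : 'M[R]_(1 + n) := block_mx 1%:M 0 0 Q.
have QQ' : Q' *m Q'^T = 1%:M.
  rewrite /Q' tr_block_mx !trmx0 trmx1.
  by rewrite mulmx_block !mulmx0 !mul0mx !addr0 !add0r mulmx1 QQ -scalar_mx_block.
have BE : B = Q'^T *m diag_mx (row_mx (l%:M) d) *m Q'.
  rewrite -(submxK B) Bul Bur Bdl DE /Q' tr_block_mx !trmx0 trmx1 diag_mx_row.
  rewrite !mulmx_block !mulmx0 !mul0mx !addr0 !add0r !mul1mx !mulmx1 ?mulmxA.
  rewrite !mul0mx; congr (block_mx _ _ _ _).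
  by apply/matrixP => i j; rewrite !ord1 !mxE eqxx mulr1 mulr1n.
exists (Q' *m P), (row_mx (l%:M) d); split.
  by rewrite trmx_mul mulmxA -(mulmxA Q' P P^T) PP mulmx1 QQ'.
by rewrite AE BE trmx_mul !mulmxA.
Qed.

End spectral.

(** * Trace inequalities *)

Section trace_estimates.
Context (R : realType) (n : nat).
Implicit Types (P Q A B : 'M[R]_n) (a b u v : 'rV[R]_n).

Lemma mxtraceB A B : \tr (A - B) = \tr A - \tr B.
Proof. by rewrite linearB. Qed.

Definition spectral_mx P a := P^T *m diag_mx a *m P.

Lemma spectral_mx_sym P a : Sym (spectral_mx P a).
Proof. by rewrite /Sym/= /spectral_mx !trmx_mul trmxK tr_diag_mx mulmxA. Qed.

Lemma spectral_mxM P u v : P *m P^T = 1%:M ->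
  spectral_mx P u *m spectral_mx P v = spectral_mx P (\row_i (u 0 i * v 0 i)).
Proof.
move=> PP; rewrite /spectral_mx !mulmxA -(mulmxA _ P P^T) PP mulmx1.
rewrite -(mulmxA P^T (diag_mx u)) mulmx_diag; congr (_ *m diag_mx _ *m _).
Qed.

Lemma expmx_spectral P a : P *m P^T = 1%:M ->
  expmx (spectral_mx P a) = spectral_mx P (\row_i expR (a 0 i)).
Proof. by move=> PP; rewrite expmx_conj// expmx_diag. Qed.

Lemma trace_spectralM P Q u v :
  \tr (spectral_mx P u *m spectral_mx Q v) =
  \sum_i \sum_j u 0 i * v 0 j * (P *m Q^T) i j ^+ 2.
Proof.
rewrite /spectral_mx -!mulmxA mxtrace_mulC.
rewrite [X in \tr X](_ : _ = (diag_mx u *m (P *m Q^T)) *m (diag_mx v *m (P *m Q^T)^T)).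
  rewrite /mxtrace; apply: eq_bigr => i _; rewrite mxE; apply: eq_bigr => j _.
  rewrite !mul_diag_mx !mxE expr2; ring.
by rewrite trmx_mul trmxK !mulmxA.
Qed.

(** The factor [spectral_mx Q (const_mx 1)] is the identity, inserted so that the trace of a single
    matrix becomes a double sum with the same weights as in [trace_spectralM], and sums can be
    compared term by term. *)
Lemma trace_spectral_l P Q u : P *m P^T = 1%:M -> Q *m Q^T = 1%:M ->
  \tr (spectral_mx P u) = \sum_i \sum_j u 0 i * (P *m Q^T) i j ^+ 2.
Proof.
move=> PP QQ; have -> : spectral_mx P u = spectral_mx P u *m spectral_mx Q (const_mx 1).
  by rewrite {3}/spectral_mx diag_const_mx mulmx1 (mulmx1C QQ) mulmx1.
rewrite trace_spectralM; apply: eq_bigr => i _; apply: eq_bigr => j _.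
by rewrite mxE mulr1.
Qed.

Lemma trace_spectral_r P Q v : P *m P^T = 1%:M -> Q *m Q^T = 1%:M ->
  \tr (spectral_mx Q v) = \sum_i \sum_j v 0 j * (P *m Q^T) i j ^+ 2.
Proof.
move=> PP QQ; have -> : spectral_mx Q v = spectral_mx P (const_mx 1) *m spectral_mx Q v.
  by rewrite {2}/spectral_mx diag_const_mx mulmx1 (mulmx1C PP) mul1mx.
rewrite trace_spectralM; apply: eq_bigr => i _; apply: eq_bigr => j _.
by rewrite mxE mul1r.
Qed.

(** Each |x_j x_k| is at most (x_j^2 + x_k^2) / 2; summing over both indices produces the factor
    n. *)
Lemma quad_bound A (x : 'rV[R]_n) :
  `|(x *m A *m x^T) 0 0| <= n%:R * `|A| * (x *m x^T) 0 0.
Proof.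
rewrite mxE (le_trans (ler_norm_sum _ _ _))//.
have xA k : `|(x *m A) 0 k * x^T k 0| <=
    \sum_j `|A| * ((x 0 j ^+ 2 + x 0 k ^+ 2) / 2).
  rewrite normrM !mxE; apply: (@le_trans _ _ (\sum_j `|x 0 j * A j k| * `|x 0 k|)).
    by rewrite -mulr_suml ler_wpM2r// ler_norm_sum.
  apply: ler_sum => j _; rewrite normrM mulrAC mulrC.
  apply: ler_pM => //; first by exact: mxnorm_ge.
  have := sqr_ge0 (`|x 0 j| - `|x 0 k|); rewrite -(real_normK (num_real (x 0 j))).
  rewrite -(real_normK (num_real (x 0 k))); nra.
apply: (le_trans (ler_sum _ (fun k _ => xA k))).
rewrite sqnormE.
under eq_bigr do rewrite -mulr_sumr -mulr_suml big_split/= sumr_const card_ord.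
rewrite -mulr_sumr -mulr_suml big_split/= sumr_const card_ord sumrMnl.
by rewrite -[_ *+ n]mulr_natl le_eqVlt; apply/orP; left; apply/eqP; field.
Qed.

Lemma spectral_quad P a (x : 'rV[R]_n) :
  (x *m spectral_mx P a *m x^T) 0 0 = \sum_i a 0 i * (x *m P^T) 0 i ^+ 2.
Proof.
rewrite /spectral_mx !mulmxA -(mulmxA _ P) -[P *m x^T]trmxK trmx_mul trmxK.
rewrite mul_mx_diag mxE; apply: eq_bigr => i _; rewrite !mxE; ring.
Qed.

Lemma orthogonal_sqnorm P (x : 'rV[R]_n) : P *m P^T = 1%:M ->
  ((x *m P^T) *m (x *m P^T)^T) 0 0 = (x *m x^T) 0 0.
Proof.
by move=> PP; rewrite trmx_mul trmxK mulmxA -(mulmxA x P^T P) (mulmx1C PP) mulmx1.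
Qed.

Lemma row_orthogonal P i : P *m P^T = 1%:M -> row i P *m P^T = delta_mx 0 i.
Proof. by move=> PP; rewrite -row_mul PP row1. Qed.

Lemma spectral_eigenvalue P a i : P *m P^T = 1%:M ->
  (row i P *m spectral_mx P a *m (row i P)^T) 0 0 = a 0 i.
Proof.
move=> PP; rewrite spectral_quad row_orthogonal// (bigD1 i)//= big1.
  by rewrite !mxE !eqxx expr1n mulr1 addr0.
by move=> j ji; rewrite !mxE (negbTE ji) andbF expr0n mulr0.
Qed.

Lemma sqnorm_row_orthogonal P i : P *m P^T = 1%:M ->
  (row i P *m (row i P)^T) 0 0 = 1.
Proof.
move=> PP; rewrite -(orthogonal_sqnorm _ PP) row_orthogonal// trmx_delta.
by rewrite mul_delta_mx !mxE !eqxx.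
Qed.

Lemma spectral_eigenvalue_bound P a i : P *m P^T = 1%:M ->
  `|a 0 i| <= n%:R * `|spectral_mx P a|.
Proof.
move=> PP; rewrite -{1}(spectral_eigenvalue a i PP) (le_trans (quad_bound _ _))//.
by rewrite sqnorm_row_orthogonal// mulr1.
Qed.

(** Both signs of D = x - y reduce to exp z >= 1 + z and give D^2 <= (1 + |D|) (1 - exp (- D)) D;
    the factor exp x >= exp (- p) turns this into a statement about exp x - exp y. The dependence on
    q is linear, which [expmx_dist] relies on. *)
Lemma exp_mono_pointwise (x y p q : R) : `|x| <= p -> `|y| <= q ->
  expR (- p) * (x - y) ^+ 2 <= (1 + p + q) * ((expR x - expR y) * (x - y)).
Proof.
move=> xp yq.
have ex : expR (- p) <= expR x.
  by rewrite ler_expR; have := ler_norm (- x); rewrite normrN; lra.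
have d0 : `|x - y| <= p + q by rewrite (le_trans (ler_normB _ _))// lerD.
have exy := expRD x (y - x).
rewrite addrC subrK in exy.
have x0 := expR_gt0 x; have d1 := expR_ge1Dx (y - x); have d2 := expR_gt0 (y - x).
have d3 := expR_ge1Dx (x - y).
have dd : expR (y - x) * expR (x - y) = 1 by rewrite -expRD addrA subrK subrr expR0.
have key : (x - y) ^+ 2 <= (1 + `|x - y|) * ((1 - expR (y - x)) * (x - y)).
  have [xy|xy] := leP 0 (x - y).
    rewrite ger0_norm//; set D := x - y in xy dd d3 *.
    rewrite -(opprB x y) -/D in d1 dd d2 *.
    have : expR (- D) * (1 + D) <= 1 by rewrite -[leRHS]dd ler_wpM2l// ltW.
    by move=> H; nra.
  rewrite ltr0_norm//; set D := x - y in xy dd d3 *.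
    rewrite -(opprB x y) -/D in d1 dd d2 *.
  by nra.
have k0 : 0 <= (expR x - expR y) * (x - y).
  rewrite exy -{1}[expR x]mulr1 -mulrBr -mulrA.
  apply: mulr_ge0; first exact: ltW.
  have := le_trans (sqr_ge0 (x - y)) key; rewrite pmulr_rge0//.
apply: (@le_trans _ _ (expR x * (x - y) ^+ 2)); first by rewrite ler_wpM2r// sqr_ge0.
apply: (@le_trans _ _ ((1 + `|x - y|) * ((expR x - expR y) * (x - y)))).
  rewrite exy -{2}[expR x]mulr1 -mulrBr -[_ * _ * (x - y)]mulrA [leRHS]mulrCA.
  by rewrite ler_wpM2l// ltW.
by rewrite ler_wpM2r//; lra.
Qed.

Lemma expmx_monotone A B : Sym A -> Sym B ->
  expR (- (n%:R * `|A|)) * \tr ((A - B) *m (A - B)) <=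
  (1 + n%:R * `|A| + n%:R * `|B|) * \tr ((expmx A - expmx B) *m (A - B)).
Proof.
move=> /sym_spectral[P [a [PP AE]]] /sym_spectral[Q [b [QQ BE]]].
rewrite -!/(spectral_mx _ _) in AE BE.
have dA i : `|a 0 i| <= n%:R * `|A| by rewrite AE; exact: spectral_eigenvalue_bound.
have dB i : `|b 0 i| <= n%:R * `|B| by rewrite BE; exact: spectral_eigenvalue_bound.
have -> : \tr ((A - B) *m (A - B)) =
    \sum_i \sum_j (a 0 i - b 0 j) ^+ 2 * (P *m Q^T) i j ^+ 2.
  rewrite mulmxBr !mulmxBl !mxtraceB (mxtrace_mulC B A) AE BE.
  rewrite !spectral_mxM// (trace_spectral_l _ PP QQ) (trace_spectral_r _ PP QQ).
  rewrite trace_spectralM -!sumrB; apply: eq_bigr => i _; rewrite -!sumrB.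
  by apply: eq_bigr => j _; rewrite !mxE; ring.
have -> : \tr ((expmx A - expmx B) *m (A - B)) =
    \sum_i \sum_j (expR (a 0 i) - expR (b 0 j)) * (a 0 i - b 0 j) * (P *m Q^T) i j ^+ 2.
  rewrite mulmxBr !mulmxBl !mxtraceB (mxtrace_mulC (expmx B) A) AE BE.
  rewrite !expmx_spectral// !spectral_mxM//.
  rewrite (trace_spectral_l _ PP QQ) (trace_spectral_r _ PP QQ).
  rewrite !trace_spectralM -!sumrB; apply: eq_bigr => i _; rewrite -!sumrB.
  by apply: eq_bigr => j _; rewrite !mxE; ring.
rewrite !mulr_sumr; apply: ler_sum => i _; rewrite !mulr_sumr; apply: ler_sum => j _.
by rewrite mulrA [leRHS]mulrA ler_wpM2r ?sqr_ge0// exp_mono_pointwise.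
Qed.

(** Termwise this is the tangent line inequality exp a (1 + b - a) <= exp b. *)
Lemma klein_expmx A B : Sym A -> Sym B ->
  \tr (expmx A) + \tr (expmx A *m (B - A)) <= \tr (expmx B).
Proof.
move=> /sym_spectral[P [a [PP AE]]] /sym_spectral[Q [b [QQ BE]]].
rewrite -!/(spectral_mx _ _) in AE BE.
rewrite mulmxBr mxtraceB AE BE !expmx_spectral// spectral_mxM//.
rewrite trace_spectralM !(trace_spectral_l _ PP QQ) (trace_spectral_r _ PP QQ).
rewrite -sumrB -big_split/=; apply: ler_sum => i _.
rewrite -sumrB -big_split/=; apply: ler_sum => j _.
rewrite !mxE -mulrBl -mulrDl ler_wpM2r ?sqr_ge0//.
have := ler_wpM2l (expR_ge0 (a 0 i)) (expR_ge1Dx (b 0 j - a 0 i)).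
by rewrite -expRD [a 0 i + (_ - _)]addrC subrK; lra.
Qed.

End trace_estimates.

(** * The differential of the matrix exponential *)

Section differential_criterion.
Context (R : realType) (V W : normedModType R).

Lemma is_diff_eps (f L : V -> W) (x : V) : linear L -> continuous L ->
  (forall e : R, 0 < e ->
     \forall y \near x, `|f y - f x - L (y - x)| <= e * `|y - x|) ->
  is_diff x f L.
Proof.
move=> lL cL feps; pose L' : {linear V -> W} :=
  HB.pack L (GRing.isLinear.Build _ _ _ _ L lL).
have fE : f \o shift x = cst (f x) + L' +o_ (0 : V) id.
  apply/eqaddoP => e e0; have /nbhs0P := feps e e0; apply: filterS => h /=.
  by rewrite /= opprD addrA (addrC x h) addrK.
have dE : 'd f x = L' :> (V -> W) by exact: diff_unique fE.
apply: DiffDef; last exact: dE.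
by apply/diff_locallyP; rewrite dE.
Qed.

Lemma diff_eps (f : V -> W) (x : V) : differentiable f x ->
  forall e : R, 0 < e ->
  \forall y \near x, `|f y - f x - 'd f x (y - x)| <= e * `|y - x|.
Proof.
move=> /diff_locallyP[_ /eqaddoP H] e e0; apply/nbhs0P.
have := H e e0; apply: filterS => h /=.
by rewrite opprD addrA (addrC x h) addrK.
Qed.

Lemma near_eq_is_diff (f g : V -> W) (x : V) :
  (\forall y \near x, f y = g y) -> differentiable f x -> is_diff x g ('d f x).
Proof.
move=> fg df; apply: is_diff_eps; [exact: linearP|exact: diff_continuous|].
move=> e e0; have := diff_eps df e0; have fgx := nbhs_singleton fg.
by apply: filterS2 fg => y fgy; rewrite fgy fgx.
Qed.

End differential_criterion.

Section expmx_differential.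
Context (R : realType).

Section block.
Context (n : nat).
Implicit Types A B X Y : 'M[R]_n.

Lemma mxX0 m (A : 'M[R]_m) : A ^+ 0 = 1%:M.
Proof. by []. Qed.

Lemma block_trigX B A X k : block_mx B X 0 A ^+ k =
  block_mx (B ^+ k) (ursubmx (block_mx B X 0 A ^+ k)) 0 (A ^+ k).
Proof.
elim: k => [|k IH].
  by rewrite !mxX0 scalar_mx_block block_mxKur.
rewrite exprS IH -mulmxE mulmx_block block_mxKur !mul0mx !mulmx0 addr0 add0r.
by rewrite add0r !mulmxE -!exprS.
Qed.

(* The divided difference of exp between B and A (see [dexpmx_sub]). *)
Definition dexpmx B A X : 'M[R]_n := ursubmx (expmx (block_mx B X 0 A)).

Lemma expmx_trig_ul B A X : ulsubmx (expmx (block_mx B X 0 A)) = expmx B.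
Proof.
apply: (@expmx_linear _ _ _ _ _ _ ulsubmx id) => // [a u v|k].
  by apply/matrixP => i j; rewrite !mxE.
by rewrite block_trigX block_mxKul.
Qed.

Lemma expmx_trig_dr B A X : drsubmx (expmx (block_mx B X 0 A)) = expmx A.
Proof.
apply: (@expmx_linear _ _ _ _ _ _ drsubmx id) => // [a u v|k].
  by apply/matrixP => i j; rewrite !mxE.
by rewrite block_trigX block_mxKdr.
Qed.

(** The corner of the k-th power is B^k - A^k: passing to k + 1 gives B (B^k - A^k) + (B - A) A^k,
    which telescopes. *)
Lemma dexpmx_sub B A : dexpmx B A (B - A) = expmx B - expmx A.
Proof.
rewrite -[in RHS](expmx_trig_ul B A (B - A)) -[in RHS](expmx_trig_dr B A (B - A)).
rewrite /dexpmx.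
apply: (@expmx_linear _ _ _ _ _ _ ursubmx (fun M => ulsubmx M - drsubmx M)).
- by move=> a u v; apply/matrixP => i j; rewrite !mxE.
- by move=> a u v; apply/matrixP => i j; rewrite !mxE; ring.
move=> k; rewrite block_trigX block_mxKul block_mxKdr block_mxKur.
elim: k => [|k IH].
  by rewrite !mxX0 subrr scalar_mx_block block_mxKur.
rewrite exprS block_trigX -mulmxE mulmx_block block_mxKur IH.
by rewrite mulmxBr mulmxBl !mulmxE -!exprS addrA subrK.
Qed.

Lemma dexpmx_cvg B A X :
  (fun N => \sum_(0 <= k < N) k`!%:R^-1 *: ursubmx (block_mx B X 0 A ^+ k)) @ \oo
    --> dexpmx B A X.
Proof.
rewrite (_ : (fun N => _) =
    ursubmx \o series (fun k => k`!%:R^-1 *: block_mx B X 0 A ^+ k)).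
  apply: continuous_cvg; last exact: cvg_expmx.
  by apply: linear_mx_continuous => a u v; apply/matrixP => i j; rewrite !mxE.
apply/funext => N; rewrite /series/=; apply/matrixP => i j.
by rewrite !mxE !summxE; apply: eq_bigr => k _; rewrite !mxE.
Qed.

Lemma dexpmx_linear B A : linear (dexpmx B A).
Proof.
have powP a X Y k : ursubmx (block_mx B (a *: X + Y) 0 A ^+ k) =
    a *: ursubmx (block_mx B X 0 A ^+ k) + ursubmx (block_mx B Y 0 A ^+ k).
  elim: k => [|k IH].
    by rewrite !mxX0 scalar_mx_block block_mxKur scaler0 addr0.
  rewrite !exprS (block_trigX B A X) (block_trigX B A Y) (block_trigX B A (_ + _)).
  rewrite -!mulmxE !mulmx_block.
  rewrite !block_mxKur IH mulmxDr mulmxDl -!scalemxAr -!scalemxAl scalerDr.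
  by rewrite addrACA.
move=> a X Y; have c1 := @dexpmx_cvg B A (a *: X + Y).
have c2 : (fun N => \sum_(0 <= k < N)
    k`!%:R^-1 *: ursubmx (block_mx B (a *: X + Y) 0 A ^+ k))
    @ \oo --> a *: dexpmx B A X + dexpmx B A Y.
  rewrite (_ : (fun N => _) = (fun N =>
    a *: (\sum_(0 <= k < N) k`!%:R^-1 *: ursubmx (block_mx B X 0 A ^+ k)) +
    \sum_(0 <= k < N) k`!%:R^-1 *: ursubmx (block_mx B Y 0 A ^+ k))).
    by apply: cvgD; [apply: cvgZl_tmp; exact: dexpmx_cvg|exact: dexpmx_cvg].
  apply/funext => N; rewrite scaler_sumr -big_split/=; apply: eq_bigr => k _.
  by rewrite powP scalerDr !scalerA mulrC.
exact: (cvg_unique _ c1 c2).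
Qed.

Lemma dexpmx_bound B A X :
  `|dexpmx B A X| <= expR ((n + n)%:R * (`|B| + `|X| + `|A|) + 1).
Proof.
have ur (M : 'M[R]_(n + n)) : `|ursubmx M| <= `|M|.
  by apply: mxnorm_le => // i j; rewrite !mxE; exact: mxnorm_ge.
apply: (le_trans (ur _)); apply: (le_trans (expmx_bound _)).
rewrite ler_expR lerD2r ler_wpM2l//; apply: mxnorm_le; first by rewrite !addr_ge0.
move=> i j; rewrite -(splitK i) -(splitK j).
case: (fintype.split i) => i'; case: (fintype.split j) => j' /=.
- by rewrite block_mxEul -addrA (le_trans (mxnorm_ge _ _ _))// lerDl addr_ge0.
- rewrite block_mxEur (le_trans (mxnorm_ge _ _ _))//.
  by rewrite addrAC lerDr addr_ge0.
- by rewrite block_mxEdl mxE normr0 !addr_ge0.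
- by rewrite block_mxEdr (le_trans (mxnorm_ge _ _ _))// lerDr addr_ge0.
Qed.

Lemma expmx_continuous : continuous (@expmx R n).
Proof.
(* C sums bounds for the values of [dexpmx B A] on the basis matrices, uniform over all B within
   distance 1 of A; with [dexpmx_sub] this is a Lipschitz estimate at A. *)
move=> A; pose C := \sum_(i < n) \sum_(j < n)
  expR ((n + n)%:R * (`|A| + 1 + `|delta_mx i j : 'M[R]_n| + `|A|) + 1).
have C0 : 0 <= C by apply: sumr_ge0 => i _; apply: sumr_ge0 => j _; exact: expR_ge0.
apply/(@cvgrPdist_le _ _ _ (nbhs A)) => e e0; near=> B.
rewrite distrC -dexpmx_sub linear_mx_sum; last exact: dexpmx_linear.
have BA1 : `|B - A| <= 1.
  by near: B; rewrite near_simpl; apply: cvgr_distC_le.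
have BAe : `|B - A| <= e / (C + 1).
  by near: B; apply: cvgr_distC_le => //; rewrite divr_gt0// ltr_wpDl.
apply: (@le_trans _ _ (`|B - A| * C)).
  rewrite /C mulr_sumr (le_trans (ler_norm_sum _ _ _))//; apply: ler_sum => i _.
  rewrite mulr_sumr (le_trans (ler_norm_sum _ _ _))//; apply: ler_sum => j _.
  rewrite normrZ ler_pM// ?mxnorm_ge// (le_trans (dexpmx_bound _ _ _))//.
  rewrite ler_expR lerD2r ler_wpM2l// !lerD2r -[B](subrK A) addrC.
  by rewrite (le_trans (ler_normD _ _))// lerD2l.
apply: (@le_trans _ _ (e / (C + 1) * (C + 1))).
  by rewrite ler_pM// lerDl.
by rewrite divfK// gt_eqF// ltr_wpDl.
Unshelve. all: by end_near. Qed.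

End block.

Lemma dexpmx_continuousl n (A X : 'M[R]_n) : continuous (fun B => dexpmx B A X).
Proof.
move=> B; have blk : (fun B : 'M[R]_n => block_mx B X 0 A) @ B --> block_mx B X 0 A.
  apply/(@cvg_mxP _ _ (nbhs B)) => i j; rewrite -(splitK i) -(splitK j).
  case: (fintype.split i) => i'; case: (fintype.split j) => j' /=.
  - rewrite block_mxEul; under eq_fun do rewrite block_mxEul; exact: coord_continuous.
  - by under eq_fun do rewrite block_mxEur; rewrite block_mxEur; exact: cvg_cst.
  - by under eq_fun do rewrite block_mxEdl; rewrite block_mxEdl; exact: cvg_cst.
  - by under eq_fun do rewrite block_mxEdr; rewrite block_mxEdr; exact: cvg_cst.
have ur : continuous (@ursubmx R n n n n).
  by apply: linear_mx_continuous => a u v; apply/matrixP => i j; rewrite !mxE.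
have eb := continuous_cvg _ (@expmx_continuous (n + n) (block_mx B X 0 A)) blk.
exact: (cvg_comp _ _ (eb (nbhs_filter B)) (ur _)).
Qed.

(** By [dexpmx_sub] the remainder at B is the difference of [dexpmx B A] and [dexpmx A A] applied to
    B - A, so continuity of [dexpmx] in its first argument, tested on the n * n basis matrices,
    suffices. *)
Global Instance is_diff_expmx n (A : 'M[R]_n) : is_diff A (@expmx R n) (dexpmx A A).
Proof.
apply: is_diff_eps; first exact: dexpmx_linear.
  exact/linear_mx_continuous/dexpmx_linear.
move=> e e0; have e1 : 0 < e / ((n * n)%:R + 1) by rewrite divr_gt0// ltr_wpDl.
have H : \forall B \near A, forall ij : 'I_n * 'I_n,
    `|dexpmx A A (delta_mx ij.1 ij.2) - dexpmx B A (delta_mx ij.1 ij.2)|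
      <= e / ((n * n)%:R + 1).
  apply: (@filter_forall _ _ _ (nbhs A)) => -[i j] /=.
  by have /(@cvgrPdist_le _ _ _ (nbhs A)) /(_ _ e1) :=
    @dexpmx_continuousl n A (delta_mx i j) A.
apply: filterS H => B H.
rewrite -dexpmx_sub !(linear_mx_sum (@dexpmx_linear _ _ _)) -sumrB.
apply: (@le_trans _ _ (\sum_(i < n) \sum_(j < n) `|B - A| * (e / ((n * n)%:R + 1)))).
  rewrite (le_trans (ler_norm_sum _ _ _))//; apply: ler_sum => i _; rewrite -sumrB.
  rewrite (le_trans (ler_norm_sum _ _ _))//; apply: ler_sum => j _.
  by rewrite -scalerBr normrZ ler_pM// ?mxnorm_ge// distrC (H (i, j)).
rewrite !sumr_const !card_ord -mulrnA -mulrnAr mulrC ler_wpM2r//.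
rewrite -mulr_natr mulrAC ler_pdivrMr ?ltr_wpDl// ler_wpM2l ?(ltW e0)//.
by rewrite lerDl.
Qed.

End expmx_differential.

(** * Calculus of C^k maps *)

Section Ck_general.
Context (R : realType) (E : normedModType R).
Implicit Types (F G : normedModType R) (U V : set E).

Lemma CkW F k U (f : E -> F) : Ck k.+1 U f -> Ck k U f.
Proof.
elim: k f => [f [df _] x Ux|k IH f [df ddf]].
  exact/differentiable_continuous/df.
by split => // v; apply: IH; exact: ddf.
Qed.

Lemma is_diff_linear F (L : E -> F) x : linear L -> continuous L -> is_diff x L L.
Proof.
move=> lL cL; pose L' : {linear E -> F} := HB.pack L (GRing.isLinear.Build _ _ _ _ L lL).
by apply: DiffDef; [exact: (linear_differentiable (f := L'))|exact: (diff_lin (f := L'))].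
Qed.

End Ck_general.

Section Ck_open.
Context (R : realType) (E : normedModType R).
Implicit Types (F G : normedModType R) (U V : set E).

Section open_set.
Context (U : set E) (oU : open U).

Lemma Ck_ext F k (f g : E -> F) : (forall x, U x -> f x = g x) ->
  Ck k U f -> Ck k U g.
Proof.
have near_fg (h h' : E -> F) x : (forall x, U x -> h x = h' x) -> U x ->
    \forall y \near x, h y = h' y.
  by move=> hh' Ux; apply: filterS (open_nbhs_nbhs (conj oU Ux)).
elim: k f g => [f g fg fc x Ux|k IH f g fg [df ddf]].
  have fgx : f @ x --> g x by rewrite -(fg x Ux); exact: fc.
  by apply: cvg_trans fgx; exact/near_eq_cvg/near_fg.
have dg x : U x -> is_diff x g ('d f x).
  by move=> Ux; apply: near_eq_is_diff; [exact: near_fg|exact: df].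
split=> [x /dg[]//|v]; apply: IH (ddf v) => x /dg[_ ->]//.
Qed.

(** Any formula valid on U may serve as the differential, whereas [Ck] speaks of the total function
    'd f, whose values off U are uncontrolled. *)
Lemma CkS F k (f : E -> F) (df : E -> E -> F) :
  (forall x, U x -> is_diff x f (df x)) -> (forall v, Ck k U (df ^~ v)) ->
  Ck k.+1 U f.
Proof.
move=> fdf Cdf; split=> [x /fdf[]//|v].
by apply: Ck_ext (Cdf v) => x /fdf[_ ->].
Qed.

Lemma Ck_cst F k (c : F) : Ck k U (cst c).
Proof.
elim: k c => [c x _|k IH c]; first exact: cst_continuous.
by apply: (@CkS _ _ _ (fun=> 0)) => v; exact: IH.
Qed.

Lemma Ck_linear_comp F G k (L : F -> G) (f : E -> F) : linear L -> continuous L ->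
  Ck k U f -> Ck k U (L \o f).
Proof.
move=> lL cL; elim: k f => [f fc x Ux|k IH f [df ddf]].
  by apply: continuous_comp; [exact: fc|exact: cL].
apply: (@CkS _ _ _ (fun x v => L ('d f x v))) => [x Ux|v]; last exact: (IH _ (ddf v)).
have dL : is_diff (f x) L L by exact: is_diff_linear.
have dfx := differentiableP (df _ Ux).
exact: is_diff_comp.
Qed.

Lemma Ck_linear F k (L : E -> F) : linear L -> continuous L -> Ck k U L.
Proof.
move=> lL cL; case: k => [x _|k]; first exact: cL.
apply: (@CkS _ _ _ (fun=> L)) => [x _|v]; last exact: Ck_cst.
exact: is_diff_linear.
Qed.

Lemma CkD F k (f g : E -> F) : Ck k U f -> Ck k U g -> Ck k U (fun x => f x + g x).
Proof.
elim: k f g => [f g fc gc x Ux|k IH f g [df ddf] [dg ddg]].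
  by apply: cvgD; [exact: fc|exact: gc].
apply: (@CkS _ _ _ (fun x v => 'd f x v + 'd g x v)) => [x Ux|v].
  have dfx := differentiableP (df _ Ux); have dgx := differentiableP (dg _ Ux).
  exact: is_diffD.
by apply: IH; [exact: ddf|exact: ddg].
Qed.

Lemma Ck_sum F k (I : Type) (r : seq I) (f : I -> E -> F) :
  (forall i, Ck k U (f i)) -> Ck k U (fun x => \sum_(i <- r) f i x).
Proof.
move=> Cf; elim: r => [|i r IH].
  by under eq_fun do rewrite big_nil; exact: Ck_cst.
by under eq_fun do rewrite big_cons; exact: CkD.
Qed.

Lemma CkB F k (f g : E -> F) : Ck k U f -> Ck k U g -> Ck k U (fun x => f x - g x).
Proof.
move=> Cf Cg; apply: CkD => //; apply: (@Ck_linear_comp _ _ _ (fun y => - y)) => //.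
  by move=> a u v; rewrite opprD scalerN.
exact: opp_continuous.
Qed.

Lemma is_diff_scale F (a : E -> R) (f : E -> F) x :
  differentiable a x -> differentiable f x ->
  is_diff x (fun y => a y *: f y) (fun v => 'd a x v *: f x + a x *: 'd f x v).
Proof.
move=> da df.
have bil : bilinear_for (GRing.Scale.Law.clone _ _ ( *:%R : R -> F -> F) _)
    (GRing.Scale.Law.clone _ _ ( *:%R : R -> F -> F) _) (fun (k : R) (v : F) => k *: v).
  by split=> [v|k] c u w /=; rewrite ?scalerDl ?scalerDr !scalerA// mulrC.
pose B : {bilinear R -> F -> F} := HB.pack (fun (k : R) (v : F) => k *: v)
  (bilinear_isBilinear.Build R R F F _ _ _ bil).
have cB : continuous (fun p : R * F => B p.1 p.2) by exact: scale_continuous.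
have dB : is_diff (a x, f x) (fun p : R * F => B p.1 p.2)
    (fun p => B (a x) p.2 + B p.1 (f x)).
  by apply: DiffDef; [exact: differentiable_bilin|exact: diff_bilin].
have dp := is_diff_pair (differentiableP da) (differentiableP df).
have := is_diff_comp dp dB; congr (is_diff _ _ _).
by apply/funext => v /=; rewrite addrC.
Qed.

Lemma Ck_scale F k (a : E -> R) (f : E -> F) :
  Ck k U a -> Ck k U f -> Ck k U (fun x => a x *: f x).
Proof.
elim: k a f => [a f ac fc x Ux|k IH a f Ca Cf].
  by apply: cvgZ; [exact: ac|exact: fc].
have [da dda] := Ca; have [df ddf] := Cf.
apply: (@CkS _ _ _ (fun x v => 'd a x v *: f x + a x *: 'd f x v)) => [x Ux|v].
  by apply: is_diff_scale; [exact: da|exact: df].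
by apply: CkD; [apply: IH; [exact: dda|exact: CkW]|apply: IH; [exact: CkW|exact: ddf]].
Qed.

Lemma CkM k (a b : E -> R) : Ck k U a -> Ck k U b -> Ck k U (fun x => a x * b x).
Proof. exact: Ck_scale. Qed.

Lemma Ck_prod k (I : Type) (r : seq I) (a : I -> E -> R) :
  (forall i, Ck k U (a i)) -> Ck k U (fun x => \prod_(i <- r) a i x).
Proof.
move=> Ca; elim: r => [|i r IH].
  by under eq_fun do rewrite big_nil; exact: Ck_cst.
by under eq_fun do rewrite big_cons; exact: CkM.
Qed.

Lemma CkV k (a : E -> R) : (forall x, U x -> a x != 0) ->
  Ck k U a -> Ck k U (fun x => (a x)^-1).
Proof.
move=> a0; elim: k => [ac x Ux|k IH Ca].
  by apply: cvgV; [exact: a0|exact: ac].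
have [da dda] := Ca.
apply: (@CkS _ _ _ (fun x v => - (a x)^-1 * (a x)^-1 * 'd a x v)) => [x Ux|v].
  have dV := differentiableV (da _ Ux) (a0 _ Ux).
  apply: DiffDef => //; rewrite diffV//; [|exact: da|exact: a0].
  by apply/funext => v /=; rewrite -exprVn expr2 -mulNr.
apply: CkM; last exact: dda.
apply: CkM; last exact/IH/CkW.
under eq_fun do rewrite -sub0r.
by apply: CkB; [exact: Ck_cst|exact/IH/CkW].
Qed.

Lemma Ck_coord m n k (f : E -> 'M[R]_(m, n)) i j :
  Ck k U f -> Ck k U (fun x => f x i j).
Proof.
move=> Cf; apply: (@Ck_linear_comp _ _ _ (fun M : 'M[R]_(m, n) => M i j : R)) => //.
  by move=> a u v; rewrite !mxE.
exact: coord_continuous.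
Qed.

Lemma Ck_mx m n k (f : E -> 'M[R]_(m, n)) :
  (forall i j, Ck k U (fun x => f x i j)) -> Ck k U f.
Proof.
move=> Cf; rewrite (_ : f = fun x => \sum_i \sum_j f x i j *: delta_mx i j).
  by do 2!apply: Ck_sum => ?; apply: Ck_scale; [exact: Cf|exact: Ck_cst].
by apply/funext => x; rewrite -matrix_sum_delta.
Qed.

(** The middle space consists of matrices, so that 'd g (f x) ('d f x v) expands along basis
    matrices into a sum of products, and the induction applies to each factor composed with f. *)
Lemma Ck_comp G m n k (V : set 'M[R]_(m, n)) (f : E -> 'M[R]_(m, n))
    (g : 'M[R]_(m, n) -> G) :
  (forall x, U x -> V (f x)) -> Ck k U f -> Ck k V g -> Ck k U (g \o f).
Proof.
move=> UV; elim: k f g UV => [f g UV fc gc x Ux|k IH f g UV Cf Cg].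
  by apply: continuous_comp; [exact: fc|exact/gc/UV].
have [df ddf] := Cf; have [dg ddg] := Cg.
apply: (@CkS _ _ _ (fun x v => \sum_i \sum_j
    ('d f x v) i j *: 'd g (f x) (delta_mx i j))) => [x Ux|v].
  have dfx := differentiableP (df _ Ux); have dgx := differentiableP (dg _ (UV _ Ux)).
  have := is_diff_comp dfx dgx; congr (is_diff _ _ _).
  apply/funext => v /=; apply: linear_mx_sum; exact: linearP.
do 2!apply: Ck_sum => ?; apply: Ck_scale; first exact/Ck_coord/ddf.
apply: (IH f (fun y => 'd g y _)) => //; [exact: CkW|exact: ddg].
Qed.

Lemma Ck_det n k (f : E -> 'M[R]_n) : Ck k U f -> Ck k U (fun x => \det (f x)).
Proof.
move=> Cf; apply: Ck_sum => s; apply: CkM; first exact: Ck_cst.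
by apply: Ck_prod => i; exact: Ck_coord.
Qed.

(** Cramer's rule: on invertible values the inverse is a rational function of the entries. *)
Lemma Ck_invmx n k (f : E -> 'M[R]_n) : (forall x, U x -> f x \in unitmx) ->
  Ck k U f -> Ck k U (fun x => invmx (f x)).
Proof.
move=> fu Cf.
apply: (@Ck_ext _ _ (fun x => (\det (f x))^-1 *: \adj (f x))) => [x Ux|].
  by rewrite /invmx fu.
apply: Ck_scale; first (apply: CkV; last exact: Ck_det).
  by move=> x /fu; rewrite unitmxE unitfE.
apply: Ck_mx => i j; under eq_fun do rewrite mxE /cofactor.
apply: CkM; first exact: Ck_cst.
apply: Ck_det; apply: Ck_mx => i' j'; under eq_fun do rewrite !mxE.
exact: Ck_coord.
Qed.

End open_set.
End Ck_open.

(** * The logarithm and the diagonal correction *)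

Section log_and_diagonal_correction.
Context (R : realType) (n : nat).
Implicit Types (A B L S D : 'M[R]_n).

Lemma SymD A B : Sym A -> Sym B -> Sym (A + B).
Proof. by rewrite /Sym/= linearD/= => -> ->. Qed.

Lemma SymN A : Sym A -> Sym (- A).
Proof. by rewrite /Sym/= linearN/= => ->. Qed.

Lemma SymB A B : Sym A -> Sym B -> Sym (A - B).
Proof. by move=> ? ?; apply: SymD => //; exact: SymN. Qed.

Lemma Diag_Sym D : Diag D -> Sym D.
Proof. by move=> /diag_mxP[d ->]; rewrite /Sym/= tr_diag_mx. Qed.

Lemma Hol_Sym A : Hol A -> Sym A. Proof. by case. Qed.

Lemma frob_symE A : Sym A -> frob A A = \sum_i \sum_j A i j ^+ 2.
Proof.
move=> As; apply: eq_bigr => i _; rewrite mxE; apply: eq_bigr => j _.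
by rewrite -[in A j i]As mxE expr2.
Qed.

Lemma frob_ge0 A : Sym A -> 0 <= frob A A.
Proof. by move=> As; rewrite frob_symE//; do 2!apply: sumr_ge0 => ? _; exact: sqr_ge0. Qed.

Lemma sqr_norm_le_frob A : Sym A -> `|A| ^+ 2 <= frob A A.
Proof.
move=> As; have f0 := frob_ge0 As.
rewrite -(@ler_sqrt _ _ (frob A A))// sqrtr_sqr normr_id; apply: mxnorm_le => // i j.
rewrite -sqrtr_sqr ler_sqrt// frob_symE// (bigD1 i)//= (bigD1 j)//= -addrA lerDl.
by apply: addr_ge0; [|apply: sumr_ge0 => ? _]; apply: sumr_ge0 => ? _; exact: sqr_ge0.
Qed.

Lemma frob_eq0 A : Sym A -> frob A A <= 0 -> A = 0.
Proof.
move=> As A0; apply/eqP; rewrite -normr_eq0 -sqrf_eq0 eq_le sqr_ge0 andbT.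
exact: le_trans (sqr_norm_le_frob As) A0.
Qed.

Lemma frob_bound A B : `|frob A B| <= n%:R * n%:R * (`|A| * `|B|).
Proof.
rewrite /frob /mxtrace (le_trans (ler_norm_sum _ _ _))// -mulrA.
rewrite -[n in n%:R * _]card_ord -sumr_const mulr_suml; apply: ler_sum => i _.
by rewrite mul1r (le_trans (mxnorm_ge _ _ _))// mxnormM.
Qed.

Lemma expmx_inj A B : Sym A -> Sym B -> expmx A = expmx B -> A = B.
Proof.
move=> As Bs AB; apply/eqP; rewrite -subr_eq0; apply/eqP.
apply: frob_eq0; first exact: SymB.
have := expmx_monotone As Bs; rewrite AB subrr mul0mx mxtrace0 mulr0.
by rewrite pmulr_rle0 ?expR_gt0.
Qed.

Lemma expmx_SymPos A : Sym A -> SymPos (expmx A).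
Proof.
move=> As; split=> [|x x0]; first exact: expmx_sym.
have [P [a [PP AE]]] := sym_spectral As.
rewrite AE -/(spectral_mx P a) expmx_spectral// spectral_quad.
have y0 : 0 < (x *m P^T *m (x *m P^T)^T) 0 0.
  rewrite orthogonal_sqnorm// lt_def sqnorm_ge0 andbT.
  by apply: contra_neq x0; exact: sqnorm_eq0.
have e0 i : 0 <= (\row_i expR (a 0 i)) 0 i * (x *m P^T) 0 i ^+ 2.
  by rewrite mxE mulr_ge0 ?expR_ge0 ?sqr_ge0.
rewrite lt_def sumr_ge0 ?andbT//; apply/eqP => /eqP; rewrite psumr_eq0//.
move=> /allP H; move: y0; rewrite sqnormE big1 ?ltxx// => i _.
have := H i (mem_index_enum _); rewrite /= mxE mulf_eq0 expR_eq0/=.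
by move=> /eqP.
Qed.

Lemma SymPos_spectral A : SymPos A -> exists (P : 'M[R]_n) (a : 'rV[R]_n),
  [/\ P *m P^T = 1%:M, A = spectral_mx P a & forall i, 0 < a 0 i].
Proof.
move=> [As Ap]; have [P [a [PP AE]]] := sym_spectral As.
exists P, a; split=> // i; rewrite -(spectral_eigenvalue a i PP) -[spectral_mx _ _]AE.
apply: Ap; apply/eqP => Pi; have := sqnorm_row_orthogonal i PP.
by rewrite Pi mul0mx mxE => /eqP; rewrite eq_sym oner_eq0.
Qed.

Lemma expmx_surj A : SymPos A -> exists L, Sym L /\ expmx L = A.
Proof.
move=> /SymPos_spectral[P [a [PP -> a0]]].
exists (spectral_mx P (\row_i ln (a 0 i))); split; first exact: spectral_mx_sym.
rewrite expmx_spectral//; congr (spectral_mx P _).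
by apply/rowP => i; rewrite !mxE lnK// posrE.
Qed.

Lemma logmxP A : SymPos A -> Sym (logmx A) /\ expmx (logmx A) = A.
Proof. by move=> /expmx_surj HL; exact: xgetPex HL. Qed.

Lemma logmx_Sym A : SymPos A -> Sym (logmx A). Proof. by case/logmxP. Qed.

Lemma logmxK A : SymPos A -> expmx (logmx A) = A. Proof. by case/logmxP. Qed.

Lemma expmxK L : Sym L -> logmx (expmx L) = L.
Proof.
move=> Ls; have [s e] := logmxP (expmx_SymPos Ls).
exact: expmx_inj.
Qed.

Lemma SymPos_nbhs A : SymPos A ->
  exists2 e : R, 0 < e & forall B, Sym B -> `|B - A| < e -> SymPos B.
Proof.
move=> Ap; have [P [a [PP AE a0]]] := SymPos_spectral Ap.
(* The default 1 caps the smallest eigenvalue and keeps c positive when n = 0. *)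
pose c := \big[Order.min/1]_i a 0 i.
have c0 : 0 < c by apply: lt_bigmin => // i _.
have ca i : c <= a 0 i by exact: bigmin_le_cond.
have cA (x : 'rV[R]_n) : c * (x *m x^T) 0 0 <= (x *m A *m x^T) 0 0.
  rewrite AE spectral_quad -(orthogonal_sqnorm x PP) sqnormE mulr_sumr.
  by apply: ler_sum => i _; rewrite ler_wpM2r// sqr_ge0.
exists (c / (n%:R + 1)); first by rewrite divr_gt0// ltr_wpDl.
move=> B Bs BA; split=> // x x0.
have s0 : 0 < (x *m x^T) 0 0.
  by rewrite lt_def sqnorm_ge0 andbT; apply: contra_neq x0; exact: sqnorm_eq0.
have -> : (x *m B *m x^T) 0 0 = (x *m A *m x^T) 0 0 + (x *m (B - A) *m x^T) 0 0.
  by rewrite -{1}[B](subrK A) addrC mulmxDr mulmxDl mxE.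
have := quad_bound (B - A) x; rewrite ler_norml => /andP[qb _].
have cx := cA x.
have : n%:R * `|B - A| < c.
  rewrite ltr_pdivlMr ?ltr_wpDl// in BA; rewrite mulrC (le_lt_trans _ BA)//.
  by rewrite ler_wpM2l// lerDl.
rewrite -(ltr_pM2r s0) => H.
by rewrite -(subr_gt0 _ (_ + _)) in H *; lra.
Qed.

(* Klein's inequality between A and its diagonal part. *)
Lemma trace_expmx_diag A : Sym A -> \sum_i expR (A i i) <= \tr (expmx A).
Proof.
move=> As; have ds : Sym (diagpart A) by apply: Diag_Sym; apply: diag_mx_is_diag.
have := klein_expmx ds As.
rewrite expmx_diag mul_diag_mx.
rewrite [X in _ + X](_ : _ = 0) ?addr0; last first.
  by rewrite /mxtrace big1// => i _; rewrite !mxE eqxx mulr1n subrr mulr0.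
by rewrite mxtrace_diag; under eq_bigr do rewrite !mxE.
Qed.

(** In the trace of [expmx_monotone] the diagonal matrix D - D' meets only the diagonals of the two
    exponentials, which agree. *)
Lemma diagcorr_unique S D D' : Sym S -> Diag D -> Diag D' ->
  CorPos (expmx (S + D)) -> CorPos (expmx (S + D')) -> D = D'.
Proof.
move=> Ss Dd Dd' [_ D1] [_ D1']; apply/eqP; rewrite -subr_eq0; apply/eqP.
have Ds := Diag_Sym Dd; have Ds' := Diag_Sym Dd'.
apply: frob_eq0; first exact: SymB.
have := expmx_monotone (SymD Ss Ds) (SymD Ss Ds').
have -> : S + D - (S + D') = D - D' by rewrite opprD addrACA subrr add0r.
rewrite [X in _ <= _ * X](_ : _ = 0) ?mulr0 ?pmulr_rle0 ?expR_gt0//.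
have /diag_mxP[d ->] : is_diag_mx (D - D').
  move: Dd Dd' => /diag_mxP[d ->] /diag_mxP[d' ->].
  by apply/diag_mxP; exists (d - d'); rewrite linearB.
by rewrite mul_mx_diag /mxtrace big1// => i _; rewrite !mxE D1 D1' subrr mul0r.
Qed.

(** F is coercive and continuous, so it has a minimiser c. Stationarity at c is extracted from
    Klein's inequality instead of a derivative of the trace. *)
Lemma diagcorr_exists S : Hol S -> exists D, Diag D /\ CorPos (expmx (S + D)).
Proof.
move=> [Ss S0].
pose F (d : 'rV[R]_n) : R := \tr (expmx (S + diag_mx d)) - \sum_i d 0 i.
have sS (d : 'rV[R]_n) : Sym (S + diag_mx d).
  by apply: SymD => //; apply: Diag_Sym; exact: diag_mx_is_diag.
(* As S has zero diagonal, this reduces to exp x - x >= |x|. For x >= 0 that is exp x >= 2 x, which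
   follows from exp (x / 2) >= 1 + x / 2 and (x / 2 - 1)^2 >= 0. *)
have Fge (d : 'rV[R]_n) : \sum_i `|d 0 i| <= F d.
  rewrite lerBrDr; apply: le_trans (trace_expmx_diag (sS d)).
  rewrite -big_split/=; apply: ler_sum => i _; rewrite !mxE S0 eqxx mulr1n add0r.
  have [d0|d0] := leP 0 (d 0 i).
    rewrite ger0_norm// [in leRHS](splitr (d 0 i)) expRD.
    have := expR_ge1Dx (d 0 i / 2); have := sqr_ge0 (d 0 i / 2 - 1); nra.
  by rewrite ltr0_norm// addNr expR_ge0.
have dl : linear (@diag_mx R n) by move=> a u v; rewrite linearP.
have Ec : continuous (fun d : 'rV[R]_n => expmx (S + diag_mx d)).
  have C0 : Ck 0 setT (@expmx R n \o (fun d : 'rV[R]_n => S + diag_mx d)).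
    apply: (Ck_comp (V := setT) openT); [by []| |by move=> x _; exact: expmx_continuous].
    apply: (CkD openT); first exact: (Ck_cst openT).
    apply: (Ck_linear openT); first exact: dl.
    exact: linear_mx_continuous.
  by move=> d; exact: C0.
have Fc : continuous F.
  have C0 : Ck 0 setT F.
    apply: (CkB openT).
      apply: (Ck_linear_comp openT (L := @mxtrace R n)
        (f := fun d : 'rV[R]_n => expmx (S + diag_mx d))).
      - by move=> a u v; rewrite linearP.
      - by apply: (@linear_mx_continuous R n n R) => a u v; rewrite linearP.
      - by move=> d _; exact: Ec.
    apply: (Ck_sum openT).
    by move=> i d _; exact: coord_continuous.
  by move=> d; exact: C0.
have Fgrad (c : 'rV[R]_n) : (forall d, F c <= F d) ->
    forall i, expmx (S + diag_mx c) i i = 1.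
  move=> cmin i; pose e : 'rV[R]_n := delta_mx 0 i.
  pose G t := expmx (S + diag_mx (c + t *: e)) i i.
  (* Klein's inequality at c + t e against c, with minimality of c, gives t (G t - 1) >= 0; both
     signs of t and continuity of G at 0 then force G 0 = 1. *)
  have tG t : 0 <= t * (G t - 1).
    have := klein_expmx (sS (c + t *: e)) (sS c); have := cmin (c + t *: e).
    rewrite /F.
    have -> : S + diag_mx c - (S + diag_mx (c + t *: e)) = - t *: diag_mx e.
      by rewrite (addrC c) dl opprD addrACA subrr add0r opprD addrCA subrr addr0 scaleNr.
    rewrite -scalemxAr linearZ/=.
    have -> : \tr (expmx (S + diag_mx (c + t *: e)) *m diag_mx e) = G t.
      rewrite mul_mx_diag /mxtrace (bigD1 i)//= big1.
        by rewrite !mxE !eqxx mulr1 addr0.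
      by move=> j ji; rewrite !mxE (negbTE ji) andbF mulr0.
    have -> : \sum_j (c + t *: e) 0 j = \sum_j c 0 j + t.
      have e1 : \sum_j e 0 j = 1.
        rewrite (bigD1 i)//= mxE !eqxx big1 ?addr0// => j ji.
        by rewrite mxE (negbTE ji) andbF.
      rewrite -[in RHS](mulr1 t) -e1 mulr_sumr -big_split/=.
      by apply: eq_bigr => j _; rewrite !mxE.
    set X := \tr _; set Y := \tr _; move=> H1 H2; lra.
  have Gc : {for 0, continuous G}.
    have C0 : Ck 0 setT ((fun M : 'M[R]_n => M i i) \o
      ((fun d : 'rV[R]_n => expmx (S + diag_mx d)) \o (fun t : R => c + t *: e))).
      apply: (Ck_comp (V := setT) openT); [by []| |by move=> M _; exact: coord_continuous].
      apply: (Ck_comp (V := setT) openT); [by []| |by move=> d _; exact: Ec].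
      apply: (CkD openT); first exact: (Ck_cst openT).
      apply: (Ck_scale openT); last exact: (Ck_cst openT).
      by move=> t _; exact: cvg_id.
    exact: (C0 0).
  have G0 : G 0 = expmx (S + diag_mx c) i i by rewrite /G scale0r addr0.
  apply/eqP; rewrite -G0 eq_le; apply/andP; split; rewrite leNgt; apply/negP => G1.
    near (0 : R)^'- => t.
    have t0 : t < 0 by near: t; exact: nbhs_left_lt.
    have : 1 < G t by near: t; apply: (cvgr_gt (G 0)) => //; exact: cvg_at_left_filter.
    by apply/negP; rewrite -leNgt; have := tG t; rewrite nmulr_rge0// subr_le0.
  near (0 : R)^'+ => t.
  have t0 : 0 < t by near: t; exact: nbhs_right_gt.
  have : G t < 1 by near: t; apply: (cvgr_lt (G 0)) => //; exact: cvg_at_right_filter.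
  by apply/negP; rewrite -leNgt; have := tG t; rewrite pmulr_rge0// subr_ge0.
(* Outside this ball F exceeds F 0 by [Fge], so a minimum over the ball is global. *)
pose K := [set d : 'rV[R]_n | `|d| <= F 0].
have F00 : 0 <= F 0 by apply: le_trans (Fge 0); exact: sumr_ge0.
have K0 : K !=set0 by exists 0; rewrite /K/= normr0.
have Kco : compact K.
  apply: bounded_closed_compact.
    exists (F 0); split=> [|M FM x Kx]; first exact: num_real.
    exact: le_trans Kx (ltW FM).
  rewrite (_ : K = (fun d : 'rV[R]_n => `|d|) @^-1` [set x | x <= F 0])//.
  by apply: preimage_closed => [x _|]; [exact: norm_continuous|exact: closed_le].
have [c] := EVT_min_rV K0 Kco (continuous_subspaceT Fc).
rewrite inE => cK cmin; exists (diag_mx c); split; first exact: diag_mx_is_diag.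
split; first exact: expmx_SymPos.
apply: Fgrad => d; have [dK|dK] := leP `|d| (F 0); first by apply: cmin; rewrite inE.
apply: (@le_trans _ _ (F 0)); first by apply: cmin; rewrite inE /K/= normr0.
apply: (le_trans (ltW dK)); apply: le_trans (Fge d); apply: mxnorm_le.
  exact: sumr_ge0.
by move=> i j; rewrite ord1 (bigD1 j)//= lerDl sumr_ge0.
Unshelve. all: by end_near. Qed.

End log_and_diagonal_correction.

(** * The implicit function theorem *)

Section implicit_function.
Context (R : realType) (E : normedModType R) (U : set E) (oU : open U) (n : nat).
Context (f : 'M[R]_n -> 'M[R]_n) (g h : E -> 'M[R]_n).
Hypothesis f_smooth : forall k, Ck k setT f.
Hypothesis h_smooth : forall k, Ck k U h.
Hypothesis g_continuous : forall x, U x -> {for x, continuous g}.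
Hypothesis fgh : forall x, U x -> f (g x) = h x.
Hypothesis df_inj : forall x, U x -> forall v, 'd f (g x) v = 0 -> v = 0.

(** J is the matrix of the differential of f at g x, acting on row vectors. T applies its inverse
    through [invmx], so that its dependence on x falls under [Ck_invmx]. *)
Let J x : 'M[R]_(n * n) := lin_mx ('d f (g x)).
Let T x (w : 'M[R]_n) : 'M[R]_n := vec_mx (mxvec w *m invmx (J x)).

Let J_unit x : U x -> J x \in unitmx.
Proof.
move=> Ux; rewrite -row_free_unit; apply: inj_row_free => v.
rewrite -[v]vec_mxK mul_vec_lin => /eqP; rewrite mxvec_eq0 => /eqP /(df_inj Ux) ->.
by rewrite linear0.
Qed.

Let T_linear x : linear (T x).
Proof. by move=> a u v; rewrite /T linearP mulmxDl -scalemxAl linearP. Qed.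

Let TK x v : U x -> T x ('d f (g x) v) = v.
Proof. by move=> Ux; rewrite /T -mul_vec_lin mulmxK ?J_unit// mxvecK. Qed.

(** Since f (g y) - f (g x) = h y - h x, the error g y - g x - T (dh (y - x)) is T applied to the
    remainders of h and f. The remainder of f, available because g is continuous, is small relative
    to g y - g x and not to y - x; it is absorbed into the left-hand side. *)
Lemma is_diff_implicit x : U x -> is_diff x g (fun v => T x ('d h x v)).
Proof.
move=> Ux; have [dh _] := h_smooth 1; have [df _] := f_smooth 1.
have cT : continuous (T x) := linear_mx_continuous (@T_linear x).
have ch : continuous ('d h x) by apply: diff_continuous; exact: dh.
pose T' : {linear 'M[R]_n -> 'M[R]_n} :=
  HB.pack (T x) (GRing.isLinear.Build _ _ _ _ (T x) (@T_linear x)).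
have [K K0 TKb] := @linear_lipschitz _ _ _ T' cT.
have [M M0 hMb] := @linear_lipschitz _ _ _ ('d h x) ch.
apply: is_diff_eps.
- by move=> a u v; rewrite linearP T_linear.
- by move=> v; apply: continuous_comp; [exact: ch|exact: cT].
move=> e e0.
(* K * d1 is the q below: q <= 1 / 2 lets q b be absorbed into b, and q K M <= e / 4. *)
pose d1 := e / (2 * e + 4 * (K * M + 1)) / K.
have KM0 : 0 < K * M by exact: mulr_gt0.
have d10 : 0 < d1 by rewrite !divr_gt0// ; lra.
have e4 : 0 < e / 4 / K by rewrite !divr_gt0.
have n1 : \forall y \near x,
    `|f (g y) - f (g x) - 'd f (g x) (g y - g x)| <= d1 * `|g y - g x|.
  by have := diff_eps (df (g x) I) d10; exact: (g_continuous Ux).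
have n2 := diff_eps (dh x Ux) e4.
have n3 : \forall y \near x, U y by apply: open_nbhs_nbhs.
apply: filterS3 n1 n2 n3 => y n1 n2 n3.
set a := `|g y - g x|; set d := `|y - x|.
set r := f (g y) - f (g x) - 'd f (g x) (g y - g x) in n1.
set r' := h y - h x - 'd h x (y - x) in n2.
have bE : g y - g x - T x ('d h x (y - x)) = T' r' - T' r.
  rewrite -[X in X - _](TK _ Ux) -[T x]/(T' : _ -> _) -!linearB; congr (T' _).
  by rewrite /r' /r !fgh// opprB [RHS]addrC subrKA.
set b := `|_|.
have b1 : b <= K * (e / 4 / K * d) + K * (d1 * a).
  rewrite /b bE (le_trans (ler_normB _ _))//; apply: lerD.
    by rewrite (le_trans (TKb _))// ler_wpM2l// ltW.
  by rewrite (le_trans (TKb _))// ler_wpM2l// ltW.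
have a1 : a <= b + K * (M * d).
  rewrite /a -[g y - g x](subrK (T x ('d h x (y - x)))) 
    (le_trans (ler_normD _ _))// lerD2l.
  by rewrite (le_trans (TKb _))// ler_pM2l.
have Kd : K * (e / 4 / K * d) = e / 4 * d by field; rewrite gt_eqF.
have Kd1 : K * (d1 * a) = e / (2 * e + 4 * (K * M + 1)) * a.
  by rewrite /d1; field; rewrite !gt_eqF//; lra.
rewrite {}Kd {}Kd1 in b1.
have d0 : 0 <= d by exact: normr_ge0.
have b0 : 0 <= b by exact: normr_ge0.
set q := e / (2 * e + 4 * (K * M + 1)) in b1.
have q0 : 0 < q by rewrite divr_gt0//; lra.
have q1 : q * (2 * e + 4 * (K * M + 1)) = e by rewrite divfK// gt_eqF//; lra.
have q2 : q <= 1 / 2.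
  by rewrite ler_pdivrMr; lra.
have q3 : q * (K * M) <= e / 4 by nra.
have : b <= e / 4 * d + q * b + e / 4 * d.
  apply: (le_trans b1); rewrite -addrA lerD2l.
  apply: (@le_trans _ _ (q * (b + K * (M * d)))); first by rewrite ler_wpM2l// ltW.
  by rewrite mulrDr lerD2l; have := ler_wpM2r d0 q3; rewrite !mulrA.
by nra.
Qed.

(** Bootstrap: the differential of g is built from 'd h and the inverse of 'd f at g x, so it is as
    regular as g, which thereby gains one order. *)
Lemma Ck_implicit k : Ck k U g.
Proof.
elim: k => [x Ux|k IH]; first exact: g_continuous.
apply: (CkS oU is_diff_implicit) => v; rewrite /T.
have lv : linear (@vec_mx R n n) by move=> a u w; rewrite linearP.
apply: (Ck_linear_comp oU lv (linear_mx_continuous lv)).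
apply: (Ck_mx oU) => i j; under eq_fun do rewrite mxE.
have lm : linear (@mxvec R n n) by move=> a u w; rewrite linearP.
apply: (Ck_sum oU) => l; apply: (CkM oU); apply: (Ck_coord oU).
  apply: (Ck_linear_comp oU lm (linear_mx_continuous lm)).
  by have [_] := h_smooth k.+1; apply.
apply: (Ck_invmx oU J_unit); apply: (Ck_mx oU) => i' j'.
under eq_fun do rewrite mxE.
apply: (Ck_coord oU); apply: (Ck_linear_comp oU lm (linear_mx_continuous lm)).
apply: (Ck_comp (V := setT) oU (g := fun y => 'd f y _)) => //.
by have [_] := f_smooth k.+1; apply.
Qed.

End implicit_function.

(** * Smoothness of exp, log and the diagonal correction *)

Section linear_functions.
Context (R : realType) (V W : lmodType R) (f : V -> W).
Hypothesis lf : linear f.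
Let L : {linear V -> W} := HB.pack f (GRing.isLinear.Build _ _ _ _ f lf).

Lemma linear_fun0 : f 0 = 0. Proof. exact: (linear0 L). Qed.

Lemma linear_funZ a u : f (a *: u) = a *: f u. Proof. exact: (linearZ_LR L). Qed.

Lemma linear_funD u v : f (u + v) = f u + f v. Proof. exact: (linearD L). Qed.

Lemma linear_funB u v : f (u - v) = f u - f v. Proof. exact: (linearB L). Qed.

End linear_functions.

Section smoothness_expmx.
Context (R : realType).

(* The derivative is itself an exponential, of block matrices of twice the
   size, hence the induction over all sizes at once. *)
Lemma Ck_expmx k n : Ck k setT (@expmx R n).
Proof.
elim: k n => [|k IH] n; first by move=> A _; exact: expmx_continuous.
apply: (CkS openT (fun A _ => is_diff_expmx A)) => X; rewrite /dexpmx.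
have lu : linear (@ursubmx R n n n n).
  by move=> a u v; apply/matrixP => i j; rewrite !mxE.
apply: (Ck_linear_comp openT lu (linear_mx_continuous lu)
  (f := fun A : 'M[R]_n => expmx (block_mx A X 0 A))).
apply: (Ck_comp (V := setT) openT (f := fun A : 'M[R]_n => block_mx A X 0 A)) => //.
have lb : linear (fun A : 'M[R]_n => block_mx A 0 0 A).
  by move=> a u v; rewrite scale_block_mx add_block_mx !scaler0 !addr0.
rewrite (_ : (fun A : 'M[R]_n => _) =
    fun A => block_mx A 0 0 A + block_mx 0 X 0 0); last first.
  by apply/funext => A; rewrite add_block_mx !addr0 add0r.
apply: (CkD openT); last exact: (Ck_cst openT).
exact: (Ck_linear openT _ lb (linear_mx_continuous lb)).
Qed.

End smoothness_expmx.

(** * Symmetric parts and positivity of the differential of exp *)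

Section symmetric_part.
Context (R : realType) (n : nat).
Implicit Types (A B L S D : 'M[R]_n).

Definition sympart A : 'M[R]_n := 2^-1 *: (A + A^T).

Lemma sympart_linear : linear sympart.
Proof. by move=> a u v; apply/matrixP => i j; rewrite !mxE; ring. Qed.

Lemma diagpart_linear : linear (@diagpart R n).
Proof.
move=> a u v; apply/matrixP => i j; rewrite !mxE.
by case: (_ == _); rewrite ?mulr1n// !mulr0n mulr0 addr0.
Qed.

Lemma off_linear : linear (@off R n).
Proof.
by move=> a u v; rewrite /off diagpart_linear scalerBr opprD addrACA.
Qed.

Lemma sympart_Sym A : Sym (sympart A).
Proof. by rewrite /Sym/= /sympart linearZ/= linearD/= trmxK addrC. Qed.

Lemma sympartK A : Sym A -> sympart A = A.
Proof.
by move=> As; apply/matrixP => i j; rewrite /sympart As !mxE; field.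
Qed.

Lemma diagpart_Diag A : Diag (diagpart A). Proof. exact: diag_mx_is_diag. Qed.

Lemma diagpart_id D : Diag D -> diagpart D = D.
Proof.
move=> /diag_mxP[d ->]; apply/matrixP => i j; rewrite !mxE eqxx mulr1n.
by case: eqP => // ->.
Qed.

Lemma off_Diag D : Diag D -> off D = 0.
Proof. by move=> Dd; rewrite /off diagpart_id// subrr. Qed.

Lemma diagpart_Hol S : Hol S -> diagpart S = 0.
Proof. by move=> [_ S0]; apply/matrixP => i j; rewrite !mxE S0 mul0rn. Qed.

Lemma off_id S : Hol S -> off S = S.
Proof. by move=> Sh; rewrite /off diagpart_Hol// subr0. Qed.

Lemma off_Hol A : Sym A -> Hol (off A).
Proof.
move=> As; split=> [|i]; last by rewrite !mxE eqxx mulr1n subrr.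
by apply: SymB => //; apply: Diag_Sym; exact: diagpart_Diag.
Qed.

Lemma off_diagpart A : off A + diagpart A = A.
Proof. by rewrite /off subrK. Qed.

Lemma frob_symskew A S : Sym S -> frob (A - sympart A) S = 0.
Proof.
move=> Ss; set K := A - sympart A.
have KT : K^T = - K by apply/matrixP => i j; rewrite !mxE; field.
have : frob K S = - frob K S.
  by rewrite {1}/frob -mxtrace_tr trmx_mul Ss KT mulmxN linearN/= mxtrace_mulC.
by move=> H; lra.
Qed.

(** Apply [expmx_monotone] to A and A + t X and divide by t^2: the positive lower bound survives as
    t tends to 0. *)
Lemma dexpmx_pos A X : Sym A -> Sym X -> frob (dexpmx A A X) X <= 0 -> X = 0.
Proof.
move=> As Xs dX; apply: frob_eq0 => //; rewrite leNgt; apply/negP => X0.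
(* C bounds the constant of [expmx_monotone] for A and A + t X whenever 0 < t <= 1. *)
pose C : R := 1 + n%:R * `|A| + n%:R * (`|A| + `|X|).
have C0 : 0 < C by rewrite /C -addrA ltr_wpDr// addr_ge0// mulr_ge0// addr_ge0.
have k0 : 0 < expR (- (n%:R * `|A|)) * frob X X / C.
  by rewrite divr_gt0// mulr_gt0// expR_gt0.
have Fc : {for 0, continuous (fun t : R => frob (dexpmx (A + t *: X) A X) X)}.
  have lf : linear (fun M : 'M[R]_n => frob M X : R).
    by move=> a u v; rewrite /frob mulmxDl mxtraceD -scalemxAl mxtraceZ.
  suff C0' : Ck 0 setT (fun t : R => frob (dexpmx (A + t *: X) A X) X) by exact: (C0' 0).
  apply: (Ck_linear_comp openT lf (linear_mx_continuous lf)
    (f := fun t : R => dexpmx (A + t *: X) A X)).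
  apply: (Ck_comp (V := setT) openT (g := fun B => dexpmx B A X)
    (f := fun t : R => A + t *: X)); [by []| |].
    apply: (CkD openT); first exact: (Ck_cst openT).
    apply: (Ck_scale openT); last exact: (Ck_cst openT).
    by move=> t _; exact: cvg_id.
  by move=> B _; exact: dexpmx_continuousl.
near (0 : R)^'+ => t.
have t0 : 0 < t by near: t; exact: nbhs_right_gt.
have t1 : t <= 1 by near: t; exact: nbhs_right_le.
have : frob (dexpmx (A + t *: X) A X) X < expR (- (n%:R * `|A|)) * frob X X / C.
  near: t; apply: (cvgr_lt (frob (dexpmx (A + 0 *: X) A X) X)).
    exact: cvg_at_right_filter.
  by rewrite scale0r addr0 (le_lt_trans dX).
apply/negP; rewrite -leNgt ler_pdivrMr// mulrC.
have tXs : Sym (t *: X) by rewrite /Sym/= linearZ/= Xs.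
have := expmx_monotone As (SymD As tXs).
rewrite opprD addNKr mulNmx mulmxN opprK -scalemxAl -scalemxAr scalerA mxtraceZ.
rewrite mulmxN -mulNmx opprB -dexpmx_sub (addrC A) addrK.
rewrite (linear_funZ (@dexpmx_linear _ _ _ _)) -scalemxAl -scalemxAr scalerA mxtraceZ.
rewrite -/(frob X X) -/(frob _ X) !(mulrCA _ (t * t)) ler_pM2l ?mulr_gt0// => H.
set F := frob (dexpmx _ _ _) X in H *.
have Y0 : 0 < 1 + n%:R * `|A| + n%:R * `|t *: X + A|.
  by rewrite -addrA ltr_wpDr// addr_ge0// mulr_ge0.
have F0 : 0 <= F.
  by rewrite -(pmulr_rge0 _ Y0) (le_trans _ H)// mulr_ge0 ?expR_ge0// ltW.
rewrite mulrC (le_trans H)// mulrC ler_wpM2l// /C lerD2l ler_wpM2l//.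
rewrite (le_trans (ler_normD _ _))// addrC lerD2l normrZ gtr0_norm// ler_piMl//.
Unshelve. all: by end_near. Qed.

End symmetric_part.

Section smoothness_log_diagcorr.
Context (R : realType) (n : nat).
Implicit Types (A B L S D : 'M[R]_n).

(* Only the norm of [A] is controlled, so this yields continuity of inverses
   of exp without any a priori bound on [B]. *)
Lemma expmx_dist A B (a c e : R) : Sym A -> Sym B -> `|A| <= a -> 0 <= c -> 0 < e ->
  \tr ((expmx A - expmx B) *m (A - B)) <= c * `|A - B| ->
  c * (1 + 2 * (n%:R * a) + n%:R * e) < expR (- (n%:R * a)) * e -> `|A - B| < e.
Proof.
move=> As Bs Aa c0 e0 H1 H2; rewrite ltNge; apply/negP => er.
set r := `|A - B| in H1 er.
have r0 : 0 < r by exact: lt_le_trans er.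
have nA : n%:R * `|A| <= n%:R * a by rewrite ler_wpM2l.
have nB : n%:R * `|B| <= n%:R * a + n%:R * r.
  rewrite -mulrDr ler_wpM2l// -[B](subKr A) (le_trans (ler_normB _ _))//.
  by rewrite lerD.
set na := n%:R * a in nA nB H2; have na0 : 0 <= na by apply: le_trans nA; exact: mulr_ge0.
have nr0 : 0 <= n%:R * r by rewrite mulr_ge0// ltW.
have k0 := expR_gt0 (- na).
have H3 : expR (- na) * r ^+ 2 <= (1 + 2 * na + n%:R * r) * (c * r).
  apply: (@le_trans _ _ (expR (- (n%:R * `|A|)) * frob (A - B) (A - B))).
    by rewrite ler_pM ?sqr_ge0 ?expR_ge0// ?ler_expR ?lerN2// sqr_norm_le_frob//; exact: SymB.
  apply: (le_trans (expmx_monotone As Bs)).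
  apply: (@le_trans _ _ ((1 + n%:R * `|A| + n%:R * `|B|) * (c * r))).
    by rewrite ler_wpM2l// !addr_ge0// mulr_ge0.
  by rewrite ler_wpM2r ?mulr_ge0 ?(ltW r0)//; lra.
have H4 : expR (- na) * r <= (1 + 2 * na + n%:R * r) * c.
  by rewrite -(ler_pM2r r0) -!mulrA -expr2.
have H5 : (1 + 2 * na) * e <= (1 + 2 * na) * r by rewrite ler_wpM2l//; lra.
have H6 : expR (- na) * r * e <= (1 + 2 * na + n%:R * r) * c * e by rewrite ler_pM2r.
have H7 : (1 + 2 * na + n%:R * r) * c * e <= c * (1 + 2 * na + n%:R * e) * r.
  have := ler_wpM2l c0 H5; nra.
have H8 : c * (1 + 2 * na + n%:R * e) * r < expR (- na) * e * r by rewrite ltr_pM2r.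
lra.
Qed.

Definition SymPos_part : set 'M[R]_n := [set A | SymPos (sympart A)].

Lemma sympart_continuous : continuous (@sympart R n).
Proof. exact/linear_mx_continuous/sympart_linear. Qed.

Lemma SymPos_part_open : open SymPos_part.
Proof.
rewrite openE => A /= Ap; rewrite /interior.
have [e e0 H] := SymPos_nbhs Ap.
have : \forall B \near A, `|sympart B - sympart A| < e.
  by have := @sympart_continuous A; move=> /cvgr_distC_lt; apply.
by apply: filterS => B BA; apply: H => //; exact: sympart_Sym.
Qed.

Lemma SymPos_SymPos_part A : SymPos A -> SymPos_part A.
Proof. by move=> Ap; rewrite /SymPos_part/= sympartK//; case: Ap. Qed.

(* Precomposing with [sympart] extends functions of symmetric matrices to open
   subsets of the space of all matrices, as smooth_on requires. *)
Definition sym_logmx A := logmx (sympart A).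

Lemma sym_logmx_continuous A : SymPos_part A -> {for A, continuous sym_logmx}.
Proof.
move=> Ap; have [Ls LE] := logmxP Ap; set L := logmx _ in Ls LE.
apply/(@cvgrPdist_lt _ _ _ (nbhs A)) => e e0.
pose C := 1 + 2 * (n%:R * `|L|) + n%:R * e.
have C0 : 0 < C by rewrite /C -addrA ltr_wpDr// addr_ge0// !mulr_ge0// ltW.
(* A distance below d between symmetric parts yields the last hypothesis of [expmx_dist], with c
   equal to n * n times that distance; the + 1 covers n = 0. *)
pose d := expR (- (n%:R * `|L|)) * e / C / (n%:R * n%:R + 1).
have d0 : 0 < d by rewrite !divr_gt0 ?mulr_gt0 ?expR_gt0// ltr_wpDl// mulr_ge0.
have n1 : \forall B \near A, `|sympart A - sympart B| < d.
  by have := @sympart_continuous A; move=> /cvgr_dist_lt; apply.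
have n2 : \forall B \near A, SymPos_part B.
  by apply: open_nbhs_nbhs; split => //; exact: SymPos_part_open.
apply: filterS2 n1 n2 => B BA Bp; have [Ms ME] := logmxP Bp.
rewrite /sym_logmx -/L.
apply: (@expmx_dist _ _ `|L| (n%:R * n%:R * `|sympart A - sympart B|)) => //.
  by rewrite LE ME -[leRHS]mulrA -/(frob _ _) (le_trans (ler_norm _))// frob_bound.
rewrite -/C -ltr_pdivlMr//.
apply: (@le_lt_trans _ _ ((n%:R * n%:R + 1) * `|sympart A - sympart B|)).
  by rewrite ler_wpM2r// lerDl.
by rewrite mulrC -ltr_pdivlMr// ltr_wpDl// mulr_ge0.
Qed.

Lemma Ck_sym_logmx k : Ck k SymPos_part sym_logmx.
Proof.
(* The skew part A - sympart A makes the differential of f injective on all matrices and not only on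
   symmetric ones. It vanishes at a logarithm, so [f (sym_logmx A)] is still [sympart A]. *)
pose f A := expmx (sympart A) + (A - sympart A).
have Cs j U (oU : open U) : Ck j U (@sympart R n).
  exact: (Ck_linear oU _ (@sympart_linear R n) sympart_continuous).
have dfE A X : 'd f A X = dexpmx (sympart A) (sympart A) (sympart X) + (X - sympart X).
  have ds := is_diff_linear A (@sympart_linear R n) sympart_continuous.
  have dx := is_diff_id A.
  have de := is_diff_comp ds (is_diff_expmx (sympart A)).
  by have [_ ->] := is_diffD de (is_diffB dx ds).
apply: (Ck_implicit SymPos_part_open (f := f) (h := @sympart R n)).
- move=> j; apply: (CkD openT).
    by apply: (Ck_comp (V := setT) openT); [by []|exact: Cs openT|exact: Ck_expmx].
  apply: (CkB openT); last exact: Cs openT.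
  by apply: (Ck_linear openT) => // B; exact: cvg_id.
- by move=> j; exact: Cs SymPos_part_open.
- exact: sym_logmx_continuous.
- by move=> A Ap; have [Ls LE] := logmxP Ap; rewrite /f sympartK// subrr addr0.
move=> A Ap X; have [Ls LE] := logmxP Ap; rewrite dfE sympartK// => H.
(* Paired with [sympart X] the skew term drops out, and [dexpmx_pos] applies. *)
have X0 : sympart X = 0.
  apply: (dexpmx_pos Ls); first exact: sympart_Sym.
  rewrite (_ : dexpmx _ _ _ = - (X - sympart X)); last by apply/eqP; rewrite -addr_eq0 H.
  by rewrite /frob mulNmx linearN/= -/(frob _ _) frob_symskew ?oppr0//; exact: sympart_Sym.
by move: H; rewrite X0 (linear_fun0 (@dexpmx_linear _ _ _ _)) add0r subr0.
Qed.

Lemma diagcorrP S : Hol S -> Diag (diagcorr S) /\ CorPos (expmx (S + diagcorr S)).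
Proof. by move=> /diagcorr_exists HD; exact: xgetPex HD. Qed.

Lemma diagcorr_Diag S : Hol S -> Diag (diagcorr S). Proof. by case/diagcorrP. Qed.

Lemma diagcorr_eq S D : Hol S -> Diag D -> CorPos (expmx (S + D)) -> diagcorr S = D.
Proof.
move=> Sh Dd SD; have [Dd' SD'] := diagcorrP Sh.
exact: diagcorr_unique (Hol_Sym Sh) Dd' Dd SD' SD.
Qed.

Definition holpart A := off (sympart A).

Lemma holpart_linear : linear holpart.
Proof. by move=> a u v; rewrite /holpart sympart_linear off_linear. Qed.

Lemma holpart_continuous : continuous holpart.
Proof. exact/linear_mx_continuous/holpart_linear. Qed.

Lemma holpart_Hol A : Hol (holpart A).
Proof. exact/off_Hol/sympart_Sym. Qed.

Lemma holpart_id S : Hol S -> holpart S = S.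
Proof. by move=> Sh; rewrite /holpart sympartK ?off_id//; exact: Hol_Sym. Qed.

Definition sym_diagcorr A := diagcorr (holpart A).

Lemma frob_Diag A D : Diag D -> (forall i, A i i = 0) -> frob A D = 0.
Proof.
move=> /diag_mxP[d ->] A0; rewrite /frob mul_mx_diag /mxtrace big1// => i _.
by rewrite !mxE A0 mul0r.
Qed.

(** The comparison is made at S + D0 and S + D, which differ by a diagonal matrix only. The
    exponentials of S + D and S0 + D0 both have unit diagonal, so against D0 - D the former can be
    replaced by the latter, and what remains is small because S is near S0. *)
Lemma sym_diagcorr_continuous : continuous sym_diagcorr.
Proof.
move=> X; have [D0d SD0] := diagcorrP (holpart_Hol X).
set S0 := holpart X in D0d SD0; set D0 := diagcorr S0 in D0d SD0.
apply/(@cvgrPdist_lt _ _ _ (nbhs X)) => e e0.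
(* This bounds the norm of S + D0 for every S within distance 1 of S0. *)
pose a := `|S0 + D0| + 1.
have a0 : 0 <= a by rewrite addr_ge0.
pose C := 1 + 2 * (n%:R * a) + n%:R * e.
have C0 : 0 < C by rewrite /C -addrA ltr_wpDr// addr_ge0// !mulr_ge0// ltW.
pose d := expR (- (n%:R * a)) * e / C / (n%:R * n%:R + 1).
have d0 : 0 < d by rewrite !divr_gt0 ?mulr_gt0 ?expR_gt0// ltr_wpDl// mulr_ge0.
have hc := @holpart_continuous X.
have n1 : \forall Y \near X, `|S0 - holpart Y| <= 1 by move/cvgr_dist_le : hc; apply.
have Ec : {for X, continuous (fun Y => expmx (holpart Y + D0))}.
  suff C0' : Ck 0 setT (fun Y => expmx (holpart Y + D0)) by exact: (C0' X).
  apply: (Ck_comp (V := setT) openT (f := fun Y => holpart Y + D0)); [by []| |exact: Ck_expmx].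
  apply: (CkD openT); last exact: (Ck_cst openT).
  exact: (Ck_linear openT _ holpart_linear holpart_continuous).
have n2 : \forall Y \near X, `|expmx (S0 + D0) - expmx (holpart Y + D0)| < d.
  by move/cvgr_dist_lt : Ec; apply.
apply: filterS2 n1 n2 => Y S1 Sd; have [Dd SD] := diagcorrP (holpart_Hol Y).
rewrite /sym_diagcorr -/S0 -/D0; set S := holpart Y in S1 Sd Dd SD *.
set D := diagcorr S in Dd SD *.
have Ss : Sym S := Hol_Sym (holpart_Hol Y).
have S0s : Sym S0 := Hol_Sym (holpart_Hol X).
clear Ec hc; clearbody D D0; clearbody S S0.
have ABE : D0 - D = (S + D0) - (S + D) by rewrite opprD addrACA subrr add0r.
rewrite ABE.
apply: (@expmx_dist _ _ a (n%:R * n%:R * `|expmx (S0 + D0) - expmx (S + D0)|)) => //.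
- exact/SymD/Diag_Sym.
- exact/SymD/Diag_Sym.
- rewrite /a (_ : S + D0 = S0 + D0 - (S0 - S)); last by rewrite addrAC subKr.
  by rewrite (le_trans (ler_normB _ _))// lerD2l.
- rewrite -ABE -/(frob _ _).
  have -> : frob (expmx (S + D0) - expmx (S + D)) (D0 - D) =
      - frob (expmx (S0 + D0) - expmx (S + D0)) (D0 - D).
    apply/eqP; rewrite -addr_eq0 /frob -mxtraceD -mulmxDl; apply/eqP.
    apply: frob_Diag => [|i].
      move: D0d Dd => /diag_mxP[u ->] /diag_mxP[v ->].
      by apply/diag_mxP; exists (u - v); rewrite linearB.
    rewrite [_ - _ + _]addrC subrKA !mxE.
    by have [_ ->] := SD0; have [_ ->] := SD; rewrite subrr.
  rewrite -[leRHS]mulrA (le_trans (ler_norm _))// normrN frob_bound//.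
rewrite -/C -ltr_pdivlMr//.
apply: (@le_lt_trans _ _ ((n%:R * n%:R + 1) * `|expmx (S0 + D0) - expmx (S + D0)|)).
  by rewrite ler_wpM2r// lerDl.
by rewrite mulrC -ltr_pdivlMr// ltr_wpDl// mulr_ge0.
Qed.

Lemma off_diagpart_eq0 A B : off A + diagpart B = 0 -> off A = 0 /\ diagpart B = 0.
Proof.
move=> AB; have B0 : diagpart B = 0.
  have := congr1 (@diagpart R n) AB; rewrite (linear_funD (@diagpart_linear _ _)).
  rewrite (linear_fun0 (@diagpart_linear _ _)) (diagpart_id (diagpart_Diag B)).
  rewrite {1}/off (linear_funB (@diagpart_linear _ _)) (diagpart_id (diagpart_Diag A)).
  by rewrite subrr add0r.
by split=> //; rewrite -AB B0 addr0.
Qed.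

(** The corrected matrix g X has a prescribed off-diagonal part and an exponential with unit
    diagonal; f collects both conditions in one equation, with right-hand side
    [holpart X + 1%:M]. *)
Lemma Ck_sym_diagcorr k : Ck k setT sym_diagcorr.
Proof.
have oc : continuous (@off R n) := linear_mx_continuous (@off_linear R n).
have dc : continuous (@diagpart R n) := linear_mx_continuous (@diagpart_linear R n).
pose f A := off A + diagpart (expmx (sympart A)).
have Ch j : Ck j setT holpart by exact: (Ck_linear openT _ holpart_linear holpart_continuous).
have dfE A X : 'd f A X = off X + diagpart (dexpmx (sympart A) (sympart A) (sympart X)).
  have ds := is_diff_linear A (@sympart_linear R n) sympart_continuous.
  have de := is_diff_comp ds (is_diff_expmx (sympart A)).
  have dd := is_diff_comp de (is_diff_linear _ (@diagpart_linear R n) dc).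
  by have [_ ->] := is_diffD (is_diff_linear A (@off_linear R n) oc) dd.
pose g X := holpart X + sym_diagcorr X.
have gs X : Sym (g X).
  apply: SymD; first exact: (Hol_Sym (holpart_Hol X)).
  exact/Diag_Sym/diagcorr_Diag/holpart_Hol.
have Cg j : Ck j setT g.
  apply: (Ck_implicit openT (f := f) (h := fun X => holpart X + 1%:M)).
  - move=> i; apply: (CkD openT); first exact: (Ck_linear openT _ (@off_linear R n) oc).
    apply: (Ck_linear_comp openT (@diagpart_linear R n) dc (f := fun A => expmx (sympart A))).
    apply: (Ck_comp (V := setT) openT); [by []| |exact: Ck_expmx].
    exact: (Ck_linear openT _ (@sympart_linear R n) sympart_continuous).
  - by move=> i; apply: (CkD openT); [exact: Ch|exact: (Ck_cst openT)].
  - move=> X _; apply: (@cvgD _ _ _ (nbhs X)); first exact: holpart_continuous.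
    exact: sym_diagcorr_continuous.
  - move=> X _; have [Dd [_ C1]] := diagcorrP (holpart_Hol X).
    rewrite /f sympartK// /g (linear_funD (@off_linear R n)) (off_id (holpart_Hol X)).
    rewrite (off_Diag Dd) addr0; congr (_ + _); apply/matrixP => i' j'.
    by rewrite !mxE C1.
  (* A kernel vector Y is diagonal, and its image under the differential of exp has zero diagonal;
     the two are orthogonal, so [dexpmx_pos] gives Y = 0. *)
  move=> X _ Y; rewrite dfE sympartK// => /off_diagpart_eq0[Y0 dY0].
  have Yd : Diag Y by rewrite -(off_diagpart Y) Y0 add0r; exact: diagpart_Diag.
  have Ys := Diag_Sym Yd; rewrite (sympartK Ys) in dY0.
  apply: (dexpmx_pos (gs X)) => //; rewrite frob_Diag// => i.
  by have /matrixP /(_ i i) := dY0; rewrite !mxE eqxx mulr1n.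
rewrite (_ : sym_diagcorr = fun X => g X - holpart X).
  by apply: (CkB openT); [exact: Cg|exact: Ch].
by apply/funext => X; rewrite /g addrC addKr.
Qed.

End smoothness_log_diagcorr.

(** * Symmetry of second derivatives *)

Section directional_derivatives.
Context (R : realType) (E F : normedModType R).

(** In tangent directions this exchanges [Phi] for its smooth extension, although the two need not
    agree on a neighbourhood. *)
Lemma derive_line (f g : E -> F) x u :
  (\forall h \near (0 : R), f (h *: u + x) = g (h *: u + x)) -> 'D_u f x = 'D_u g x.
Proof.
move=> fg; have fgx : f x = g x.
  by have := nbhs_singleton fg; rewrite scale0r add0r.
have fg' := nbhs_dnbhs fg.
rewrite /derive; congr (lim _); apply/seteqP; split=> A /= H;
  (apply: filterS2 fg' H => h /= fgh; by rewrite fgh fgx).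
Qed.

Lemma is_derive_line (f : E -> F) x u s : differentiable f (x + s *: u) ->
  is_derive s 1 (fun t : R => f (x + t *: u)) ('d f (x + s *: u) u).
Proof.
move=> df; have dl : is_diff s (fun t : R => x + t *: u) (fun t => t *: u).
  have := is_diffD (is_diff_cst x s) (is_diff_scalel s u).
  by congr (is_diff _ _ _); apply/funext => t /=; rewrite add0r.
have [dc dcE] := is_diff_comp dl (differentiableP df).
split; first exact: diff_derivable.
by rewrite (deriveE _ dc) dcE /= scale1r.
Qed.

End directional_derivatives.

Section linear_image.
Context (R : realType) (E F G : normedModType R).
Context (L : F -> G) (lL : linear L) (cL : continuous L).

Lemma diff_linear_comp (f : E -> F) x v : differentiable f x ->
  'd (L \o f) x v = L ('d f x v).
Proof.
move=> df; have [_ ->] // := is_diff_comp (differentiableP df) (is_diff_linear _ lL cL).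
Qed.

(** Passes linear constraints to derivatives: L encodes a subspace as its kernel, and f has only to
    stay in one fibre of L along the line. *)
Lemma diff_line_cst (f : E -> F) x u (c : G) : differentiable f x ->
  (\forall h \near (0 : R), L (f (h *: u + x)) = c) -> L ('d f x u) = 0.
Proof.
move=> df fc; rewrite -diff_linear_comp// -deriveE; last first.
  by have [] := is_diff_comp (differentiableP df) (is_diff_linear _ lL cL).
by rewrite (@derive_line _ _ _ _ (cst c)) ?derive_cst.
Qed.

End linear_image.

Section schwarz.
Context (R : realType) (E : normedModType R).

(** Two mean value theorems: in the direction u for the increment of f along d v, then in the
    direction v for the derivative of f along u. *)
Lemma second_difference (U : set E) (f : E -> R) x u v (d : R) : Ck 2 U f -> 0 < d ->
  (forall s t, 0 <= s <= d -> 0 <= t <= d -> U (x + s *: u + t *: v)) ->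
  exists s t, [/\ 0 <= s <= d, 0 <= t <= d &
    f (x + d *: u + d *: v) - f (x + d *: u) - (f (x + d *: v) - f x) =
    d ^+ 2 * 'd (fun y => 'd f y u) (x + s *: u + t *: v) v].
Proof.
move=> [df ddf] d0 box.
have dd : 0 <= d <= d by apply/andP; split=> //; exact: ltW.
have zd : 0 <= (0 : R) <= d by apply/andP; split=> //; exact: ltW.
pose p s := f (x + s *: u + d *: v) - f (x + s *: u).
pose dp s := 'd f (x + s *: u + d *: v) u - 'd f (x + s *: u) u.
have dpE s : 0 <= s <= d -> is_derive s 1 p (dp s).
  move=> sd; apply: is_deriveB.
    have e t : x + t *: u + d *: v = x + d *: v + t *: u by rewrite addrAC.
    rewrite e (_ : (fun s => _) = fun s => f (x + d *: v + s *: u)).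
      by apply: is_derive_line; rewrite -e; apply: df; exact: box.
    by apply/funext => t; rewrite e.
  apply: is_derive_line; apply: df.
  by have := box s 0 sd zd; rewrite scale0r addr0.
have [s sd pE] : exists2 s, s \in `]0, d[ & p d - p 0 = dp s * (d - 0).
  apply: MVT => // [s|].
    by rewrite in_itv/= => /andP[s0 sd]; apply: dpE; rewrite !ltW.
  apply: derivable_within_continuous => s; rewrite in_itv/= => sd.
  by have [] := dpE s sd.
have {}sd : 0 <= s <= d by move: sd; rewrite in_itv/= => /andP[? ?]; rewrite !ltW.
have [ddf' _] := ddf u.
pose q t := 'd f (x + s *: u + t *: v) u.
pose dq t := 'd (fun y => 'd f y u) (x + s *: u + t *: v) v.
have dqE t : 0 <= t <= d -> is_derive t 1 q (dq t).
  by move=> td; apply: is_derive_line; apply: ddf'; exact: box.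
have [t td qE] : exists2 t, t \in `]0, d[ & q d - q 0 = dq t * (d - 0).
  apply: MVT => // [t|].
    by rewrite in_itv/= => /andP[t0 td]; apply: dqE; rewrite !ltW.
  apply: derivable_within_continuous => t; rewrite in_itv/= => td.
  by have [] := dqE t td.
exists s, t; split=> //.
  by move: td; rewrite in_itv/= => /andP[? ?]; rewrite !ltW.
rewrite -/(dq t) expr2 -mulrA [d * dq t]mulrC -[X in dq t * X]subr0 -qE.
have -> : q d - q 0 = dp s by rewrite /q /dp scale0r addr0.
by rewrite mulrC -[X in dp s * X]subr0 -pE /p scale0r addr0.
Qed.

(** If the mixed derivatives differed, continuity would separate them by a value m on a small
    parallelogram, while the second difference, unchanged when u and v are exchanged, is d^2 times a
    value of either. *)
Theorem Ck2_symmetric (U : set E) (f : E -> R) x u v : open U -> U x -> Ck 2 U f ->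
  'd (fun y => 'd f y v) x u = 'd (fun y => 'd f y u) x v.
Proof.
move=> oU Ux f2.
wlog suff H : u v / 'd (fun y => 'd f y v) x u <= 'd (fun y => 'd f y u) x v.
  by apply/eqP; rewrite eq_le !H.
rewrite leNgt; apply/negP => ab.
set a := 'd (fun y => 'd f y v) x u in ab *; set b := 'd (fun y => 'd f y u) x v in ab *.
have cont w z : {for x, continuous (fun y => 'd (fun y => 'd f y w) y z)}.
  have [_ ddf] := f2; have [_ dddf] := ddf w.
  exact: (dddf z).
pose m := (a + b) / 2.
have n1 : \forall y \near x, m < 'd (fun y => 'd f y v) y u.
  by apply: (cvgr_gt a (cont v u)); rewrite /m; lra.
have n2 : \forall y \near x, 'd (fun y => 'd f y u) y v < m.
  by apply: (cvgr_lt b (cont u v)); rewrite /m; lra.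
have n3 : \forall y \near x, U y by exact: open_nbhs_nbhs.
have /nbhs_normP[r r0 rH] : \forall y \near x,
    [/\ m < 'd (fun y => 'd f y v) y u, 'd (fun y => 'd f y u) y v < m & U y].
  by apply: filterS3 n1 n2 n3.
(* This keeps the whole parallelogram in the ball of radius r; the + 1 gives strictness and a
   nonzero denominator. *)
pose d := r / (`|u| + `|v| + 1).
have uv0 : 0 < `|u| + `|v| + 1 by rewrite ltr_wpDl// addr_ge0.
have d0 : 0 < d by rewrite divr_gt0.
have dr : d * (`|u| + `|v| + 1) = r by rewrite divfK// gt_eqF.
have box s t : 0 <= s <= d -> 0 <= t <= d ->
    [/\ m < 'd (fun y => 'd f y v) (x + s *: u + t *: v) u,
        'd (fun y => 'd f y u) (x + s *: u + t *: v) v < m & U (x + s *: u + t *: v)].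
  move=> /andP[s0 sd] /andP[t0 td]; apply: rH.
  rewrite /= -addrA opprD addNKr normrN (le_lt_trans (ler_normD _ _))// !normrZ !ger0_norm//.
  rewrite -dr !mulrDr mulr1 (@le_lt_trans _ _ (d * `|u| + d * `|v|))//.
    by rewrite lerD// ler_wpM2r.
  by rewrite ltrDl.
have [s [t [sd td E1]]] := second_difference f2 d0
  (fun s t sd td => let: And3 _ _ p := box s t sd td in p).
have box' s' t' : 0 <= s' <= d -> 0 <= t' <= d -> U (x + s' *: v + t' *: u).
  by move=> sd' td'; rewrite addrAC; have [] := box t' s' td' sd'.
have [s' [t' [sd' td' E2]]] := second_difference f2 d0 box'.
have [_ B1 _] := box s t sd td.
have [B2 _ _] := box t' s' td' sd'; rewrite addrAC in B2.
have d20 : 0 < d ^+ 2 by rewrite exprn_gt0.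
have := ltr_pM2l d20 ('d (fun y => 'd f y u) (x + s *: u + t *: v) v)
  ('d (fun y => 'd f y v) (x + s' *: v + t' *: u) u).
rewrite (lt_trans B1 B2) -E1 -E2 [x + d *: v + d *: u]addrAC => /idP.
by apply/negP; rewrite -leNgt le_eqVlt; apply/orP; left; apply/eqP; ring.
Qed.

Lemma Ck2_symmetric_linear (F : normedModType R) (U : set E) (f : E -> F)
    (L : F -> R) x u v : linear L -> continuous L ->
  open U -> U x -> Ck 2 U f ->
  L ('d (fun y => 'd f y v) x u) = L ('d (fun y => 'd f y u) x v).
Proof.
move=> lL cL oU Ux f2; have [df ddf] := f2.
have dL w z : 'd (fun y => 'd (L \o f) y w) x z = L ('d (fun y => 'd f y w) x z).
  have [ddfw _] := ddf w.
  rewrite -(diff_linear_comp lL cL _ (ddfw _ Ux)).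
  have dd : differentiable (L \o (fun y => 'd f y w)) x.
    by have [] := is_diff_comp (differentiableP (ddfw _ Ux)) (is_diff_linear _ lL cL).
  have nr : \forall y \near x, (L \o (fun y => 'd f y w)) y = 'd (L \o f) y w.
    apply: filterS (open_nbhs_nbhs (conj oU Ux)) => y Uy.
    by rewrite /= -(diff_linear_comp lL cL _ (df _ Uy)).
  by have [_ ->] := near_eq_is_diff nr dd.
by rewrite -!dL; apply: (Ck2_symmetric _ _ oU Ux); exact: Ck_linear_comp.
Qed.

End schwarz.

(** * The diffeomorphism Phi *)

Section Phi_diffeomorphism.
Context (R : realType) (n : nat).
Notation M := 'M[R]_n.
Implicit Types (A B S D C : M) (p q Z : M * M).

Lemma Phi_HolDiag A : SymPos A -> (@Hol R n `*` @Diag R n) (Phi A).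
Proof.
move=> Ap; split; first exact/off_Hol/logmx_Sym.
move: (diagpart_Diag (logmx A)) (diagcorr_Diag (off_Hol (logmx_Sym Ap))).
move=> /diag_mxP[u uE] /diag_mxP[v vE]; rewrite /Diag/= uE vE.
by apply/diag_mxP; exists (u - v); rewrite linearB.
Qed.

Lemma Phiinv_Sym p : (@Hol R n `*` @Diag R n) p -> Sym (p.1 + diagcorr p.1 + p.2).
Proof.
move=> [Sh Dd]; apply: SymD; last exact: Diag_Sym.
by apply: SymD; [exact: Hol_Sym|exact/Diag_Sym/diagcorr_Diag].
Qed.

Lemma Phiinv_SymPos p : (@Hol R n `*` @Diag R n) p -> SymPos (Phiinv p).
Proof. by move=> /Phiinv_Sym; exact: expmx_SymPos. Qed.

Lemma PhiK A : SymPos A -> Phiinv (Phi A) = A.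
Proof.
move=> Ap; rewrite /Phiinv /Phi/= -addrA (addrC (diagcorr _)) subrK off_diagpart.
exact: logmxK.
Qed.

Lemma PhiinvK p : (@Hol R n `*` @Diag R n) p -> Phi (Phiinv p) = p.
Proof.
move=> pHD; have [Sh Dd] := pHD; rewrite /Phi /Phiinv (expmxK (Phiinv_Sym pHD)).
have Dd' := diagcorr_Diag Sh.
have oE : off (p.1 + diagcorr p.1 + p.2) = p.1.
  by rewrite !(linear_funD (@off_linear R n)) off_id// !off_Diag// !addr0.
have dE : diagpart (p.1 + diagcorr p.1 + p.2) = diagcorr p.1 + p.2.
  rewrite !(linear_funD (@diagpart_linear R n)) (diagpart_Hol Sh).
  by rewrite (diagpart_id Dd) (diagpart_id Dd') add0r.
by rewrite oE dE addrAC subrr add0r -surjective_pairing.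
Qed.

Lemma CorPos_SymPos C : CorPos C -> SymPos C. Proof. by case. Qed.

(** log C is its off-diagonal part plus a diagonal matrix, and its exponential is a correlation
    matrix; by uniqueness that diagonal matrix is the correction. *)
Lemma Phi_CorPos C : CorPos C -> Phi C = (off (logmx C), 0).
Proof.
move=> CC; have Cp := CorPos_SymPos CC; rewrite /Phi; congr (_, _).
rewrite (@diagcorr_eq _ _ _ (diagpart (logmx C))) ?subrr//.
- exact/off_Hol/logmx_Sym.
- exact: diagpart_Diag.
by rewrite off_diagpart logmxK.
Qed.

Lemma Phiinv_CorPos S : Hol S -> CorPos (Phiinv (S, 0)).
Proof. by move=> Sh; rewrite /Phiinv/= addr0; have [] := diagcorrP Sh. Qed.

Lemma Phi_image_CorPos : @Phi R n @` @CorPos R n = @Hol R n `*` [set 0].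
Proof.
apply/seteqP; split=> [_ [C CC <-]|[S D] [/= Sh ->]].
  by rewrite Phi_CorPos//; split=> //; exact/off_Hol/logmx_Sym/CorPos_SymPos.
exists (Phiinv (S, 0)); first exact: Phiinv_CorPos.
by rewrite PhiinvK//; split=> //=; rewrite /Diag/= mx0_is_diag.
Qed.

Definition sym_Phi A := Phi (sympart A).
Definition sym_Phiinv p := expmx (p.1 + sym_diagcorr p.1 + p.2).

Lemma Ck_pair (E : normedModType R) (U : set E) (f g : E -> M) k : open U ->
  Ck k U f -> Ck k U g -> Ck k U (fun x => (f x, g x)).
Proof.
move=> oU Cf Cg; have li : linear (fun A : M => (A, 0 : M)).
  by move=> a u v; apply: injective_projections; rewrite /= ?scaler0 ?addr0.
have lj : linear (fun A : M => (0 : M, A)).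
  by move=> a u v; apply: injective_projections; rewrite /= ?scaler0 ?addr0.
rewrite (_ : (fun x => _) = fun x => (f x, 0 : M) + (0 : M, g x)); last first.
  by apply/funext => x; apply: injective_projections; rewrite /= ?addr0 ?add0r.
apply: (CkD oU).
  exact: (Ck_linear_comp oU li (linear_mx_continuous li)).
exact: (Ck_linear_comp oU lj (linear_mx_continuous lj)).
Qed.

Lemma Ck_sym_Phi k : Ck k (@SymPos_part R n) sym_Phi.
Proof.
have oU := @SymPos_part_open R n.
have oc : continuous (@off R n) := linear_mx_continuous (@off_linear R n).
have dc : continuous (@diagpart R n) := linear_mx_continuous (@diagpart_linear R n).
have Cl := @Ck_sym_logmx R n k.
apply: (Ck_ext oU (f := fun A => (off (sym_logmx A), diagpart (sym_logmx A) - sym_diagcorr (sym_logmx A)))).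
  move=> A Ap; rewrite /sym_Phi /Phi /sym_diagcorr /holpart /sym_logmx (sympartK (logmx_Sym Ap))//.
apply: (Ck_pair oU).
  exact: (Ck_linear_comp oU (@off_linear R n) oc).
apply: (CkB oU); first exact: (Ck_linear_comp oU (@diagpart_linear R n) dc).
by apply: (Ck_comp (V := setT) oU); [by []|exact: Cl|exact: Ck_sym_diagcorr].
Qed.

Lemma fst_linear : linear (@fst M M). Proof. by []. Qed.
Lemma snd_linear : linear (@snd M M). Proof. by []. Qed.
Lemma fst_continuous : continuous (@fst M M). Proof. by move=> p; exact: cvg_fst. Qed.
Lemma snd_continuous : continuous (@snd M M). Proof. by move=> p; exact: cvg_snd. Qed.

Lemma Ck_sym_Phiinv k : Ck k setT sym_Phiinv.
Proof.
have C1 := Ck_linear (@openT (M * M)%type) k fst_linear fst_continuous.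
have C2 := Ck_linear (@openT (M * M)%type) k snd_linear snd_continuous.
apply: (Ck_comp (V := setT) openT (f := fun p => p.1 + sym_diagcorr p.1 + p.2));
  [by []| |exact: Ck_expmx].
apply: (CkD openT); last exact: C2.
apply: (CkD openT); first exact: C1.
by apply: (Ck_comp (V := setT) openT); [by []|exact: C1|exact: Ck_sym_diagcorr].
Qed.

Lemma sym_PhiE A : Sym A -> sym_Phi A = Phi A.
Proof. by move=> As; rewrite /sym_Phi sympartK. Qed.

Lemma sym_PhiinvE p : Hol p.1 -> sym_Phiinv p = Phiinv p.
Proof. by move=> ph; rewrite /sym_Phiinv /sym_diagcorr holpart_id. Qed.

Lemma Phi_diffeomorphism : diffeomorphism (@SymPos R n) (@Hol R n `*` @Diag R n)
  (@Phi R n) (@Phiinv R n).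
Proof.
split; [exact: Phi_HolDiag|exact: Phiinv_SymPos|exact: PhiK|exact: PhiinvK|split].
  move=> A Ap; exists (@SymPos_part R n), sym_Phi; split.
  - exact: SymPos_part_open.
  - exact: SymPos_SymPos_part.
  - exact: Ck_sym_Phi.
  - by move=> B _ [Bs _]; exact: sym_PhiE.
move=> p _; exists setT, sym_Phiinv; split.
- exact: openT.
- by [].
- exact: Ck_sym_Phiinv.
- by move=> q _ [qh _]; exact: sym_PhiinvE.
Qed.

End Phi_diffeomorphism.

(** * The Riemannian metrics *)

Section riemannian.
Context (R : realType) (n : nat).
Notation M := 'M[R]_n.
Implicit Types (A B C S D u v w : M) (p q Z : M * M).

Lemma frobC A B : frob A B = frob B A.
Proof. exact: mxtrace_mulC. Qed.

Lemma frob_linearl B : linear (fun A : M => frob A B : R).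
Proof. by move=> a u v; rewrite /frob mulmxDl mxtraceD -scalemxAl mxtraceZ. Qed.

Lemma frob2C p q : frob2 p q = frob2 q p.
Proof. by rewrite /frob2 frobC (frobC p.2). Qed.

Lemma frob2_linearl q : linear (fun p : M * M => frob2 p q : R).
Proof. by move=> a u v; rewrite /frob2 /= !frob_linearl /= scalerDr addrACA. Qed.

Lemma frob2_linearr q : linear (fun p : M * M => frob2 q p : R).
Proof. by move=> a u v; rewrite ![frob2 q _]frob2C frob2_linearl. Qed.

Lemma frob2_continuousl q : continuous (fun p : M * M => frob2 p q : R).
Proof.
have fc B : continuous (fun A : M => frob A B : R).
  exact/linear_mx_continuous/frob_linearl.
move=> p; apply: (@cvgD _ _ _ (nbhs p)).
  exact: (cvg_comp _ _ (@fst_continuous R n p) (fc q.1 _)).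
exact: (cvg_comp _ _ (@snd_continuous R n p) (fc q.2 _)).
Qed.

Lemma frob2_eq0 p : Sym p.1 -> Sym p.2 -> frob2 p p <= 0 -> p = 0.
Proof.
move=> s1 s2 p0; have f1 := frob_ge0 s1; have f2 := frob_ge0 s2.
have e1 : p.1 = 0 by apply: frob_eq0 => //; move: p0; rewrite /frob2; lra.
have e2 : p.2 = 0 by apply: frob_eq0 => //; move: p0; rewrite /frob2; lra.
by rewrite [p]surjective_pairing e1 e2.
Qed.

Lemma Ck_frob2 (E : normedModType R) (U : set E) (f g : E -> M * M) k : open U ->
  Ck k U f -> Ck k U g -> Ck k U (fun x => frob2 (f x) (g x)).
Proof.
move=> oU Cf Cg; have Cfst h : Ck k U h -> Ck k U (fun x => (h x : M * M).1).
  exact: (Ck_linear_comp oU (@fst_linear R n) (@fst_continuous R n)).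
have Csnd h : Ck k U h -> Ck k U (fun x => (h x : M * M).2).
  exact: (Ck_linear_comp oU (@snd_linear R n) (@snd_continuous R n)).
have Cfrob (a b : E -> M) : Ck k U a -> Ck k U b -> Ck k U (fun x => frob (a x) (b x)).
  move=> Ca Cb; apply: (Ck_sum oU) => i; under eq_fun do rewrite mxE.
  by apply: (Ck_sum oU) => j; apply: (CkM oU); apply: (Ck_coord oU).
by apply: (CkD oU); apply: Cfrob; (exact: Cfst || exact: Csnd).
Qed.

Lemma Sym_scaleD a u A : Sym u -> Sym A -> Sym (a *: u + A : M).
Proof. by move=> us As; apply: SymD => //; rewrite /Sym/= linearZ/= us. Qed.

Lemma Hol_scaleD a u A : Hol u -> Hol A -> Hol (a *: u + A : M).
Proof.
move=> [us u0] [As A0]; split; first exact: Sym_scaleD.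
by move=> i; rewrite !mxE u0 A0 mulr0 addr0.
Qed.

Lemma SymPos_flat : flat_submanifold (@SymPos R n) (@Sym R n).
Proof.
split=> [|a u v|A Ap]; [by rewrite /Sym/= trmx0|exact: Sym_scaleD|].
have [e e0 H] := SymPos_nbhs Ap; have As : Sym A by case: Ap.
apply/nbhs_normP; exists e => // B /= BA; split=> [[Bs _]|BAs]; first exact: SymB.
apply: H; last by rewrite distrC.
by rewrite -[B](subrK A); exact: SymD.
Qed.

Lemma CorPos_flat : flat_submanifold (@CorPos R n) (@Hol R n).
Proof.
split=> [|a u v|A [Ap A1]]; [|exact: Hol_scaleD|].
  by split=> [|i]; rewrite ?trmx0// mxE.
have [_ _ /(_ A Ap)] := SymPos_flat; apply: filterS => B BA.
split=> [[/BA Bs B1]|[BAs BA0]]; first by split=> // i; rewrite !mxE B1 A1 subrr.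
split; first exact/BA.
by move=> i; have := BA0 i; rewrite !mxE A1 => /eqP; rewrite subr_eq0 => /eqP.
Qed.

Lemma near_line (E : normedModType R) (X V : set E) y (z : E) :
  flat_submanifold X V -> X y -> V z -> \forall h \near (0 : R), X (h *: z + y).
Proof.
move=> [V0 VD XV] Xy Vz.
have /nbhs0P/(near0Z z) := XV y Xy; apply: filterS => h.
rewrite addrC addrK => -[_]; apply; rewrite -[h *: z]addr0; exact: VD.
Qed.

Lemma differentiable_sym_Phi A : SymPos A -> differentiable (@sym_Phi R n) A.
Proof.
by move=> Ap; have [dP _] := @Ck_sym_Phi R n 1; apply: dP; exact: SymPos_SymPos_part.
Qed.

Lemma differentiable_sym_Phiinv p : differentiable (@sym_Phiinv R n) p.
Proof. by have [dP _] := @Ck_sym_Phiinv R n 1; exact: dP. Qed.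

Lemma derive_Phi A u : SymPos A -> Sym u -> 'D_u (@Phi R n) A = 'd (@sym_Phi R n) A u.
Proof.
move=> Ap us; rewrite -deriveE; last exact: differentiable_sym_Phi.
apply: derive_line; apply: (@filterE _ (nbhs (0 : R))) => h; rewrite sym_PhiE//.
by apply: Sym_scaleD => //; case: Ap.
Qed.

Lemma gextE A u v : SymPos A -> Sym u -> Sym v ->
  gext A u v = frob2 ('d (@sym_Phi R n) A u) ('d (@sym_Phi R n) A v).
Proof. by move=> Ap us vs; rewrite /gext /pullback_metric !derive_Phi. Qed.

Lemma dPhi_line (G : normedModType R) (L : M * M -> G) c X V A u :
  linear L -> continuous L -> X `<=` @SymPos R n -> V `<=` @Sym R n ->
  flat_submanifold X V -> (forall B, X B -> L (Phi B) = c) -> X A -> V u ->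
  L ('d (@sym_Phi R n) A u) = 0.
Proof.
move=> lL cL XS VS XV XL XA Vu; have Ap := XS _ XA.
apply: (diff_line_cst (c := c) lL cL (differentiable_sym_Phi Ap)).
have := near_line XV XA Vu; apply: filterS => h Xh.
by rewrite sym_PhiE ?XL//; case: (XS _ Xh).
Qed.

(** Needed for definiteness, since [frob2] is positive on symmetric pairs but not on arbitrary
    ones. *)
Lemma dPhi_Sym A u : SymPos A -> Sym u ->
  Sym ('d (@sym_Phi R n) A u).1 /\ Sym ('d (@sym_Phi R n) A u).2.
Proof.
move=> Ap us.
have K (L : M * M -> M) : linear L -> continuous L ->
    (forall B, SymPos B -> Sym (L (Phi B))) -> Sym (L ('d (@sym_Phi R n) A u)).
  move=> lL cL HL; pose L' p := L p - sympart (L p).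
  have lL' : linear L'.
    by move=> a p q; rewrite /L' lL sympart_linear scalerBr opprD addrACA.
  have cL' : continuous L'.
    move=> p; apply: (@cvgB _ _ _ (nbhs p)); first exact: cL.
    exact: (cvg_comp _ _ (cL p) (@sympart_continuous R n _)).
  have /eqP : L' ('d (@sym_Phi R n) A u) = 0.
    apply: (dPhi_line (c := 0) lL' cL' _ _ SymPos_flat) => // B Bp.
    by rewrite /L' sympartK ?subrr//; exact: HL.
  by rewrite subr_eq0 => /eqP ->; exact: sympart_Sym.
have HD B : SymPos B -> Sym (Phi B).1 /\ Sym (Phi B).2.
  by move=> /Phi_HolDiag[/Hol_Sym ? /Diag_Sym ?].
split; apply: K.
- exact: fst_linear.
- exact: fst_continuous.
- by move=> B /HD[].
- exact: snd_linear.
- exact: snd_continuous.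
- by move=> B /HD[].
Qed.

(** A linear map with kernel Hol + {0}, so that [diff_line_cst] can act on membership in that
    subspace. *)
Definition holproj p : M * M := (p.1 - holpart p.1, p.2).

Lemma holproj_eq0 p : holproj p = 0 -> Hol p.1 /\ p.2 = 0.
Proof.
rewrite /holproj => -[/eqP]; rewrite subr_eq0 => /eqP -> ->.
by split => //; exact: holpart_Hol.
Qed.

Lemma holproj_linear : linear holproj.
Proof.
move=> a p q; apply: injective_projections; last by [].
change (a *: p.1 + q.1 - holpart (a *: p.1 + q.1) =
  a *: (p.1 - holpart p.1) + (q.1 - holpart q.1)).
by rewrite holpart_linear opprD addrACA -scalerN -scalerDr.
Qed.

Lemma holproj_continuous : continuous holproj.
Proof.
move=> p; apply: (@cvg_pair _ _ _ (nbhs p) (nbhs (p.1 - holpart p.1)) (nbhs p.2));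
  last exact: snd_continuous.
apply: (@cvgB _ _ _ (nbhs p)); first exact: fst_continuous.
exact: (cvg_comp _ _ (@fst_continuous R n p) (@holpart_continuous R n _)).
Qed.

Lemma holproj_Phi C : CorPos C -> holproj (Phi C) = 0.
Proof.
move=> CC; rewrite Phi_CorPos// /holproj/= holpart_id ?subrr//.
exact/off_Hol/logmx_Sym/CorPos_SymPos.
Qed.

Lemma dPhi_Hol C u : CorPos C -> Hol u -> holproj ('d (@sym_Phi R n) C u) = 0.
Proof.
move=> CC uh; apply: (dPhi_line (c := 0) holproj_linear holproj_continuous _ _
  CorPos_flat) => //.
- by move=> B; exact: CorPos_SymPos.
- by move=> B; exact: Hol_Sym.
- exact: holproj_Phi.
Qed.

(** [Phiinv] undoes [Phi] on a segment through A in the direction u, and the chain rule applies to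
    the smooth extensions. *)
Lemma dPhi_inj A u : SymPos A -> Sym u -> 'd (@sym_Phi R n) A u = 0 -> u = 0.
Proof.
move=> Ap us du0.
have [dc dcE] := is_diff_comp (differentiableP (differentiable_sym_Phi Ap))
  (differentiableP (differentiable_sym_Phiinv (sym_Phi A))).
have : 'D_u (@sym_Phiinv R n \o @sym_Phi R n) A = u.
  rewrite (@derive_line _ _ _ _ id) ?derive_id//.
  have := near_line SymPos_flat Ap us; apply: filterS => h Xh /=.
  rewrite sym_PhiE; last by case: Xh.
  by rewrite sym_PhiinvE ?PhiK//; have [] := Phi_HolDiag Xh.
by rewrite deriveE// dcE/= du0 linear0.
Qed.

(** The witness is the image of Z under the differential of the inverse. The line h Z + Phi C stays
    in Hol + {0}, so the inverse maps it to correlation matrices; hence the witness is hollow, and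
    the chain rule along this line returns Z. *)
Lemma dPhi_Hol_surj C Z : CorPos C -> Hol Z.1 -> Z.2 = 0 ->
  exists w, Hol w /\ 'd (@sym_Phi R n) C w = Z.
Proof.
move=> CC Zh Z0; have Cp := CorPos_SymPos CC.
have [PC PD] := Phi_HolDiag Cp; have [P'C P'D] : Hol (Phi C).1 /\ (Phi C).2 = 0.
  exact/holproj_eq0/holproj_Phi.
have line h : CorPos (sym_Phiinv (h *: Z + Phi C)) /\
    sym_Phi (sym_Phiinv (h *: Z + Phi C)) = h *: Z + Phi C.
  have hh : Hol (h *: Z + Phi C).1 by exact: Hol_scaleD.
  have h0 : (h *: Z + Phi C).2 = 0.
    by rewrite -[LHS]/(h *: Z.2 + (Phi C).2) P'D Z0 scaler0 addr0.
  rewrite sym_PhiinvE// [h *: Z + _]surjective_pairing h0.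
  have iC := Phiinv_CorPos hh; split => //.
  rewrite sym_PhiE; last by case: (CorPos_SymPos iC).
  by rewrite PhiinvK//; split=> //=; rewrite /Diag/= mx0_is_diag.
have CE : sym_Phiinv (Phi C) = C by rewrite sym_PhiinvE// PhiK.
have dI := differentiableP (differentiable_sym_Phiinv (Phi C)).
have dP : differentiable (@sym_Phi R n) (sym_Phiinv (Phi C)).
  by rewrite CE; exact: differentiable_sym_Phi.
exists ('d (@sym_Phiinv R n) (Phi C) Z); split.
  (* The kernel of L is [Hol], and L is constantly the identity matrix on correlation matrices. *)
  pose L A : M := A - holpart A.
  have lL : linear L.
    by move=> a u v; rewrite /L holpart_linear opprD addrACA -scalerN -scalerDr.
  have cL : continuous L := linear_mx_continuous lL.
  have /eqP : L ('d (@sym_Phiinv R n) (Phi C) Z) = 0.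
    apply: (diff_line_cst (c := 1%:M) lL cL) => //.
    apply: (@filterE _ (nbhs (0 : R))) => h; have [[[hs hp] h1] _] := line h.
    move: hs h1; set B := sym_Phiinv _ => hs h1.
    rewrite /L /holpart sympartK// /off opprB addrC subrK.
    by apply/matrixP => i j; rewrite !mxE h1.
  by rewrite subr_eq0 => /eqP ->; exact: holpart_Hol.
have [dc dcE] := is_diff_comp dI (differentiableP dP).
have : 'D_Z (@sym_Phi R n \o @sym_Phiinv R n) (Phi C) = Z.
  rewrite (@derive_line _ _ _ _ id) ?derive_id//.
  by apply: (@filterE _ (nbhs (0 : R))) => h /=; have [] := line h.
by rewrite deriveE// dcE/= CE.
Qed.

End riemannian.

(** * Derivatives of the metric, the isometric embedding and geodesics *)

Section metrics.
Context (R : realType) (n : nat).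
Notation M := 'M[R]_n.
Implicit Types (A B C S D u v w : M) (p q Z : M * M).

Lemma is_diff_frob2 (E : normedModType R) (f g : E -> M * M) z :
  differentiable f z -> differentiable g z ->
  is_diff z (fun y => frob2 (f y) (g y))
    (fun e => frob2 (f z) ('d g z e) + frob2 ('d f z e) (g z)).
Proof.
move=> df dg.
have bil : bilinear_for (GRing.Scale.Law.clone _ _ ( *:%R : R -> R -> R) _)
    (GRing.Scale.Law.clone _ _ ( *:%R : R -> R -> R) _) (@frob2 R n).
  by split=> [q|p] a u v /=; [exact: frob2_linearl|exact: frob2_linearr].
pose B : {bilinear (M * M)%type -> (M * M)%type -> R} := HB.pack (@frob2 R n)
  (bilinear_isBilinear.Build R (M * M)%type (M * M)%type R _ _ _ bil).
have cB : continuous (fun pq : (M * M) * (M * M) => B pq.1 pq.2).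
  have C0 : Ck 0 setT (fun pq : (M * M) * (M * M) => frob2 pq.1 pq.2).
    apply: (Ck_frob2 openT) => p _; [exact: cvg_fst|exact: cvg_snd].
  by move=> p; exact: C0.
have dB : is_diff (f z, g z) (fun pq : (M * M) * (M * M) => B pq.1 pq.2)
    (fun pq => B (f z) pq.2 + B pq.1 (g z)).
  by apply: DiffDef; [exact: differentiable_bilin|exact: diff_bilin].
exact: is_diff_comp (is_diff_pair (differentiableP df) (differentiableP dg)) dB.
Qed.

Lemma differentiable_dPhi A u : SymPos A ->
  differentiable (fun B => 'd (@sym_Phi R n) B u) A.
Proof.
move=> Ap; have [_ ddP] := @Ck_sym_Phi R n 2.
by have [dP _] := ddP u; apply: dP; exact: SymPos_SymPos_part.
Qed.

Lemma derive_gext A u v w : SymPos A -> Sym u -> Sym v -> Sym w ->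
  'D_w (fun B => gext B u v) A =
    frob2 ('d (@sym_Phi R n) A u) ('d (fun B => 'd (@sym_Phi R n) B v) A w) +
    frob2 ('d (fun B => 'd (@sym_Phi R n) B u) A w) ('d (@sym_Phi R n) A v).
Proof.
move=> Ap us vs ws.
have [dd ddE] := is_diff_frob2 (differentiable_dPhi u Ap) (differentiable_dPhi v Ap).
transitivity ('D_w (fun B => frob2 ('d (@sym_Phi R n) B u) ('d (@sym_Phi R n) B v)) A).
  apply: derive_line; have := near_line (@SymPos_flat R n) Ap ws.
  by apply: filterS => h Bp; exact: gextE.
by rewrite deriveE// ddE.
Qed.

(* The Koszul formula for the flat metric pulled back by Phi: the Christoffel
   vector c satisfies dPhi c = D^2 Phi (u, u). *)
Lemma gext_koszul A u w : SymPos A -> Sym u -> Sym w ->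
  2^-1 * ('D_u (fun B => gext B u w) A + 'D_u (fun B => gext B u w) A
          - 'D_w (fun B => gext B u u) A) =
  frob2 ('d (fun B => 'd (@sym_Phi R n) B u) A u) ('d (@sym_Phi R n) A w).
Proof.
move=> Ap us ws.
(* The surviving term is b; a = d is the symmetry of the second derivative of Phi, and c = d the
   symmetry of [frob2]. *)
have half (X Y a b c d : R) :
    X = a + b -> Y = c + d -> a = d -> c = d -> 2^-1 * (X + X - Y) = b.
  by move=> -> -> -> ->; field.
apply: half (derive_gext Ap us ws us) (derive_gext Ap us us ws) _ (frob2C _ _).
rewrite frob2C; apply: (Ck2_symmetric_linear _ _ (@frob2_linearl R n _)
  (@frob2_continuousl R n _) (@SymPos_part_open R n)).
- exact: SymPos_SymPos_part.
- exact: Ck_sym_Phi.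
Qed.

Lemma gext_linear A a u v w : SymPos A -> Sym u -> Sym v -> Sym w ->
  gext A (a *: u + v) w = a * gext A u w + gext A v w.
Proof.
move=> Ap us vs ws; rewrite !gextE//; last exact: Sym_scaleD.
by rewrite linearP frob2_linearl.
Qed.

Lemma gext_sym A u v : gext A u v = gext A v u.
Proof. exact: frob2C. Qed.

Lemma gext_gt0 A u : SymPos A -> Sym u -> u != 0 -> 0 < gext A u u.
Proof.
move=> Ap us u0; rewrite gextE// ltNge; apply: contra u0 => du.
have [s1 s2] := dPhi_Sym Ap us.
by apply/eqP; apply: (dPhi_inj Ap us); exact: frob2_eq0.
Qed.

Lemma gext_smooth u v : Sym u -> Sym v ->
  smooth_on (@SymPos R n) (fun A => gext A u v).
Proof.
move=> us vs A Ap; exists (@SymPos_part R n),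
  (fun B => frob2 ('d (@sym_Phi R n) B u) ('d (@sym_Phi R n) B v)); split.
- exact: SymPos_part_open.
- exact: SymPos_SymPos_part.
- move=> k; have [_ dP] := @Ck_sym_Phi R n k.+1.
  by apply: (Ck_frob2 (@SymPos_part_open R n)); exact: dP.
- by move=> B _ Bp; rewrite gextE.
Qed.

Lemma SymPos_riemannian : riemannian_manifold (@SymPos R n) (@Sym R n) (@gext R n).
Proof.
split; [exact: SymPos_flat|by move=> *; exact: gext_linear|by move=> *; exact: gext_sym| |].
  by move=> *; exact: gext_gt0.
exact: gext_smooth.
Qed.

(** In a hollow direction the second component of dPhi vanishes, and the first is the derivative of
    [offlog]. *)
Lemma gOLE C u v : CorPos C -> Hol u -> Hol v -> gOL C u v = gext C u v.
Proof.
move=> CC uh vh; have Cp := CorPos_SymPos CC.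
have us := Hol_Sym uh; have vs := Hol_Sym vh.
have D w : Sym w -> 'D_w (@offlog R n) C = ('d (@sym_Phi R n) C w).1.
  move=> ws; have dP := differentiable_sym_Phi Cp.
  rewrite -(diff_linear_comp (@fst_linear R n) (@fst_continuous R n))// -deriveE.
    apply: derive_line; apply: (@filterE _ (nbhs (0 : R))) => h.
    rewrite -[RHS]/((sym_Phi (h *: w + C)).1) sym_PhiE; first by [].
    by apply: Sym_scaleD => //; case: Cp.
  by have [] := is_diff_comp (differentiableP dP)
    (is_diff_linear _ (@fst_linear R n) (@fst_continuous R n)).
rewrite /gOL /pullback_metric !D// gextE// /frob2.
have [_ ->] := holproj_eq0 (dPhi_Hol CC uh).
by rewrite [X in _ + X]/frob mul0mx mxtrace0 addr0.
Qed.

Lemma CorPos_riemannian : riemannian_manifold (@CorPos R n) (@Hol R n) (@gOL R n).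
Proof.
split; first exact: CorPos_flat.
- move=> C CC a u v w uh vh wh; rewrite !gOLE//; last exact: Hol_scaleD.
  by apply: gext_linear; [exact: CorPos_SymPos|exact: Hol_Sym..].
- move=> C CC u v uh vh.
  exact: etrans (gOLE CC uh vh) (etrans (gext_sym C u v) (esym (gOLE CC vh uh))).
- move=> C CC u uh u0; rewrite (gOLE CC uh uh).
  exact: gext_gt0 (CorPos_SymPos CC) (Hol_Sym uh) u0.
move=> u v uh vh C CC.
have [U [f' [oU UC Cf fE]]] :=
  gext_smooth (Hol_Sym uh) (Hol_Sym vh) (CorPos_SymPos CC).
exists U, f'; split; [exact: oU|exact: UC|exact: Cf|move=> B UB BC].
exact: etrans (fE B UB (CorPos_SymPos BC)) (esym (gOLE BC uh vh)).
Qed.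

Lemma smooth_on_id (X : set M) : smooth_on X (fun A => A).
Proof.
move=> A XA; exists setT, id; split; [exact: openT|by []| |by []].
by move=> k; apply: (Ck_linear openT) => // B; exact: cvg_id.
Qed.

Lemma CorPos_isometric_embedding : riemannian_isometric_embedding
  (@CorPos R n) (@Hol R n) (@gOL R n) (@SymPos R n) (@Sym R n) (@gext R n)
  (fun C : M => C).
Proof.
split; [exact: CorPos_riemannian|exact: SymPos_riemannian| |].
  split; [exact: CorPos_SymPos|exact: smooth_on_id| |].
    by move=> C u _ _; rewrite derive_id.
  exists id; split => //; rewrite image_id.
  by apply: continuous_subspaceT => B; exact: cvg_id.
move=> C u v CC uh vh; rewrite /pullback_metric !derive_id.
exact: esym (gOLE CC uh vh).
Qed.

Lemma geodesic_velocity_Hol (I : set R) (gamma : R -> M) t : open I -> I t ->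
  (forall s, I s -> CorPos (gamma s)) -> smooth_on I gamma -> Hol (derive1 gamma t).
Proof.
move=> oI It gC gs; have [U [f' [oU Ut Cf fE]]] := gs t It.
have nf : \forall s \near t, f' s = gamma s.
  by apply: filterS2 (open_nbhs_nbhs (conj oU Ut))
    (open_nbhs_nbhs (conj oI It)) => s; exact: fE.
have [df _] := Cf 1.
have [dg _] := near_eq_is_diff nf (df _ Ut).
rewrite derive1E deriveE//.
have nC : \forall h \near (0 : R), CorPos (gamma (h *: 1 + t)).
  have /nbhs0P := open_nbhs_nbhs (conj oI It); apply: filterS => h It'.
  by apply: gC; rewrite [h *: 1]mulr1 addrC.
pose L A : M := A - holpart A.
have lL : linear L.
  by move=> a u v; rewrite /L holpart_linear opprD addrACA -scalerN -scalerDr.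
have /eqP : L ('d gamma t 1) = 0.
  apply: (diff_line_cst (c := 1%:M) lL (linear_mx_continuous lL)) => //.
  apply: filterS nC => h [[hs _] h1].
  rewrite /L /holpart sympartK// /off opprB addrC subrK.
  by apply/matrixP => i j; rewrite !mxE h1.
by rewrite subr_eq0 => /eqP ->; exact: holpart_Hol.
Qed.

Lemma CorPos_totally_geodesic : totally_geodesic
  (@CorPos R n) (@Hol R n) (@SymPos R n) (@Sym R n) (@gext R n).
Proof.
split; [exact: CorPos_SymPos|exact: CorPos_flat|move=> I gamma oI _ [gC gs gG]].
split=> [t /gC|//|t It]; first exact: CorPos_SymPos.
have [] := gG t It; set u := derive1 gamma t; set c := - _ => ch cE.
have uh : Hol u by exact: (geodesic_velocity_Hol oI).
have CC := gC t It; set C := gamma t in CC cE *.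
have Cp := CorPos_SymPos CC; have us := Hol_Sym uh; have cs := Hol_Sym ch.
(* With c = - gamma'', the defect in the ambient geodesic equation is Z; the aim is Z = 0. *)
pose d2 := 'd (fun B => 'd (@sym_Phi R n) B u) C u.
pose Z := d2 - 'd (@sym_Phi R n) C c.
(* Along the line through C in the hollow direction u, the vector dPhi u stays in Hol + {0}, and so
   does its derivative d2. *)
have Zh : holproj Z = 0.
  rewrite /Z (linear_funB (@holproj_linear R n)) (dPhi_Hol CC ch) subr0.
  apply: (diff_line_cst (c := 0) (@holproj_linear R n) (@holproj_continuous R n)).
    exact: differentiable_dPhi.
  have := near_line (@CorPos_flat R n) CC uh; apply: filterS => h BC.
  exact: dPhi_Hol.
have [Z1 Z2] := holproj_eq0 Zh.
(* Tested against w0, whose image under dPhi is Z, the tangential equation reads frob2 Z Z = 0. *)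
have [w0 [w0h w0E]] := dPhi_Hol_surj CC Z1 Z2.
have Z0 : Z = 0.
  apply: frob2_eq0; [exact: Hol_Sym|by rewrite Z2 /Sym/= trmx0|].
  have cw := etrans (esym (gextE Cp cs (Hol_Sym w0h)))
    (etrans (cE w0 w0h) (gext_koszul Cp us (Hol_Sym w0h))).
  have cZ : frob2 ('d (@sym_Phi R n) C c) Z = frob2 d2 Z :=
    eq_ind _ (fun q => frob2 ('d (@sym_Phi R n) C c) q = frob2 d2 q) cw _ w0E.
  have ZZ : frob2 Z Z = 0 :=
    etrans (linear_funB (@frob2_linearl R n Z) d2 ('d (@sym_Phi R n) C c))
      (etrans (congr1 (fun r => frob2 d2 Z - r) cZ) (subrr _)).
  by rewrite ZZ.
split=> [|w ws]; first exact: cs.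
have Zc : 'd (@sym_Phi R n) C c = d2 by apply/eqP; rewrite eq_sym -subr_eq0; apply/eqP.
exact: etrans (gextE Cp cs ws) (etrans
  (congr1 (fun q => frob2 q ('d (@sym_Phi R n) C w)) Zc) (esym (gext_koszul Cp us ws))).
Qed.

End metrics.

Theorem theorem4p27 (R : realType) (n : nat) :
  [/\ diffeomorphism (@SymPos R n) (@Hol R n `*` @Diag R n)
        (@Phi R n) (@Phiinv R n),
      riemannian_isometric_embedding
        (@CorPos R n) (@Hol R n) (@gOL R n)
        (@SymPos R n) (@Sym R n) (@gext R n)
        (fun C : 'M[R]_n => C),
      totally_geodesic
        ((fun C : 'M[R]_n => C) @` @CorPos R n) (@Hol R n)
        (@SymPos R n) (@Sym R n) (@gext R n) &
      @Phi R n @` @CorPos R n = @Hol R n `*` [set 0]].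
Proof.
split; [exact: Phi_diffeomorphism|exact: CorPos_isometric_embedding| |].
  by rewrite image_id; exact: CorPos_totally_geodesic.
exact: Phi_image_CorPos.
Qed.
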